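(* Let $H$ be a low pass filter and let $S\ge 2$ be an integer. There exist positive constants $C_1\ge 1$, $C_2$, $C_3$ depending only on $H$ such that the following holds. Let $K\ge 1$ be an integer, let $\lambda_1,\dots,\lambda_K\in\mathbb{T}$ be distinct, let $A_1,\dots,A_K\in\mathbb{C}\setminus\{0\}$, let $n\ge 1$ be an integer, and for $\ell\in\mathbb{Z}$, $|\ell|<n$, let each $\epsilon_\ell$ be a realization of a sub-Gaussian random variable in $\mathcal{G}(V)$. Put $$M=\sum_{k=1}^K|A_k|,\qquad \mathfrak{m}=\min_{1\le k\le K}|A_k|,\qquad \eta=\min_{\ell\ne k}|\lambda_k-\lambda_\ell|,\qquad L=\frac{14\sqrt{2\pi}}{3}\cdot\frac{\|H^{(S)}\|_1}{\|H\|_1},$$ $$\tilde\mu(\ell)=\sum_{k=1}^K A_k e^{-i\ell\lambda_k}+\epsilon_\ell\quad(|\ell|<n),\qquad \sigma_n(x)=\hbar_n\sum_{|\ell|<n}H\left(\frac{|\ell|}{n}\right)\tilde\mu(\ell)e^{i\ell x}\quad (x\in\mathbb{T}).$$ Let $0<\delta<1$, $$\mathbb{G}=\{x\in[-\pi,\pi]:\ |\sigma_n(x)|\ge \mathfrak{m}/2\},\qquad C=\max\left(1,\left(\frac{16ML}{\mathfrak{m}}\right)^{1/S}\right).$$ Suppose that $n$ is sufficiently large, namely $$n\ge\max(4C/\eta,\,C_1)\qquad\text{and}\qquad C_2V\sqrt{\frac{\log(C_3n/\delta)}{n}}\le\frac{\mathfrak{m}}{16}.$$ Then each of the following statements holds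 with probability exceeding $1-\delta$. (1) (Disjoint union condition) The set $\mathbb{G}$ is a disjoint union of exactly $K$ subsets $\mathbb{G}_\ell$, $\ell=1,\dots,K$. (2) (Diameter condition) For each $\ell=1,\dots,K$, $\mathrm{diam}(\mathbb{G}_\ell)\le 2C/n$. (3) (Separation) $\mathrm{dist}(\mathbb{G}_\ell,\mathbb{G}_k)\ge\eta/2$ for $\ell\ne k$. (4) (Interval inclusion) For each $\ell=1,\dots,K$, $I_\ell=\{x\in\mathbb{T}:|x-\lambda_\ell|\le 1/(4n)\}\subseteq\mathbb{G}_\ell$. Moreover, if $$\hat\lambda_\ell=\arg\max_{x\in\mathbb{G}_\ell}|\sigma_n(x)|,$$ then $$|\hat\lambda_\ell-\lambda_\ell|\le 2C/n.$$
   Context: $\mathbb{T}=\mathbb{R}/(2\pi\mathbb{Z})$, i.e. $x$ and $y$ are considered equal if $x=y$ mod $2\pi$; it is identified with $[-\pi,\pi]$ with endpoints identified, and $|x-y|$ for $x,y\in\mathbb{T}$ is the distance modulo $2\pi$. If $K=1$, $\eta$ is interpreted as $+\infty$. A low pass filter is an infinitely differentiable function $H:\mathbb{R}\to[0,1]$ with $H(t)=H(-t)$ for all $t$, $H(t)=1$ if $|t|\le 1/2$, and $H(t)=0$ if $|t|\ge 1$. For a function $g$ vanishing outside $[-1,1]$, $\|g\|_1=\int_{-1}^1|g(t)|\,dt$; $H^{(S)}$ is the $S$-th derivative of $H$. The normalizing constant is $\hbar_n=\left\{\sum_{|\ell|<n}H(|\ell|/n)\right\}^{-1}$. A mean zero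 real random variable $X$ is in $\mathcal{G}(\nu)$ (sub-Gaussian with parameter $\nu$) if $\log\mathbb{E}(\exp(tX))\le (t\nu)^2/2$. A complex random variable is in $\mathcal{G}(\nu)$ if both its real and imaginary parts are in $\mathcal{G}(\nu)$.
   Formalization: The formal statement additionally assumes that the noise variables ε_ℓ, |ℓ|<n, are mutually independent; without this the claim fails, e.g. when all ε_ℓ equal one Gaussian variable of variance V². *)

(* Defs.v *)
From HB Require Import structures.
From mathcomp Require Import all_boot all_order all_algebra.
From mathcomp Require Import all_classical all_reals all_analysis.
From mathcomp Require Export complex.
From mathcomp Require Import finmap.

Set Implicit Arguments.
Unset Strict Implicit.
Unset Printing Implicit Defensive.

Import Order.TTheory GRing.Theory Num.Theory.
Import numFieldNormedType.Exports.

Local Open Scope classical_set_scope.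
Local Open Scope ring_scope.
Local Open Scope complex_scope.

Section Circle.
Context {R : realType}.

Definition eq_mod2pi (x y : R) : bool := (x - y) / (2 * pi) \is a Num.int.

Lemma eq_mod2pi_refl : reflexive eq_mod2pi.
Proof. by move=> x; rewrite /eq_mod2pi subrr mul0r rpred0. Qed.

Lemma eq_mod2pi_sym : symmetric eq_mod2pi.
Proof. by move=> x y; rewrite /eq_mod2pi -opprB mulNr rpredN. Qed.

Lemma eq_mod2pi_trans : transitive eq_mod2pi.
Proof.
move=> y x z; rewrite /eq_mod2pi => xy yz.
by rewrite -(subrKA y) mulrDl rpredD.
Qed.

Canonical eq_mod2pi_equiv :=
  EquivRel eq_mod2pi eq_mod2pi_refl eq_mod2pi_sym eq_mod2pi_trans.

End Circle.

(* R / 2 pi Z.  For x : circle R, the real number [repr x] is an arbitrarily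
   chosen representative of the class x; it is only used in expressions that
   do not depend on this choice. *)
Definition circle (R : realType) := {eq_quot (@eq_mod2pi_equiv R)}%qT.

Section CircleDistance.
Context {R : realType}.
Implicit Types (x y : circle R) (A B : set (circle R)).

Definition cdist x y : R :=
  inf [set `|repr x - repr y + j%:~R * (2 * pi)| | j in [set: int]].

Definition cdiam A : \bar R :=
  ereal_sup [set (cdist p.1 p.2)%:E | p in A `*` A].

Definition cset_dist A B : \bar R :=
  ereal_inf [set (cdist p.1 p.2)%:E | p in A `*` B].

(* Equal to +oo when K <= 1. *)
Definition min_sep (K : nat) (lam : 'I_K -> circle R) : \bar R :=
  \big[mine/+oo%E]_(p : 'I_K * 'I_K | p.1 != p.2) (cdist (lam p.1) (lam p.2))%:E.

End CircleDistance.

Section Filter.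
Context {R : realType}.
Implicit Types (H g : R -> R) (n : nat).

Definition low_pass_filter H : Prop :=
  [/\ forall (k : nat) (t : R), derivable (derive1n k H) t 1,
      forall t, 0 <= H t <= 1,
      forall t, H t = H (- t),
      forall t, `|t| <= 2^-1 -> H t = 1
    & forall t, 1 <= `|t| -> H t = 0].

Definition norm1 g : R := \int[lebesgue_measure]_(t in `[(-1 : R), 1]) `|g t|.

Definition freqs n : set int := [set l | (`|l| < n)%N].

Definition hbar H n : R := (\sum_(l \in freqs n) H (`|l|%N%:R / n%:R))^-1.

Definition expi (t : R) : R[i] := cos t +i* sin t.

Definition sigma H n (mu : int -> R[i]) (x : circle R) : R[i] :=
  (hbar H n)%:C *
  \sum_(l \in freqs n) (H (`|l|%N%:R / n%:R))%:C * mu l * expi (l%:~R * repr x).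

Definition exp_sum (K : nat) (lam : 'I_K -> circle R) (A : 'I_K -> R[i])
    (l : int) : R[i] :=
  \sum_(k < K) A k * expi (- (l%:~R * repr (lam k))).

End Filter.

(* The library norm on R[i] takes its values in R[i]; normc takes them in R. *)
Notation cmod := (@Normc.normc _).

(* [fine] is harmless when K >= 1: the minimum is then a finite number. *)
Definition min_cmod (R : realType) (K : nat) (A : 'I_K -> R[i]) : R :=
  fine (\big[mine/+oo%E]_(k < K) (cmod (A k))%:E).

Definition is_argmax (R : realType) (X : Type) (D : set X) (f : X -> R) (x : X) :=
  D x /\ forall y, D y -> f y <= f x.

Section Probability.
Context {d : measure_display} {Omega : measurableType d} {R : realType}.
Variable P : probability Omega R.

(* lne maps +oo to +oo, so the last clause forces the moment generating
   function to be finite everywhere. *)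
Definition subgaussian (nu : R) (X : Omega -> R) : Prop :=
  [/\ measurable_fun [set: Omega] X,
      ('E_P[X] = 0)%E
    & forall t : R, (lne ('M_P X t) <= ((t * nu) ^+ 2 / 2)%:E)%E].

Definition csubgaussian (nu : R) (X : Omega -> R[i]) : Prop :=
  subgaussian nu (fun w => complex.Re (X w)) /\
  subgaussian nu (fun w => complex.Im (X w)).

(* Mutual independence of (X j), j in J, as random vectors of R^2 : nothing is
   assumed on the joint law of the real and imaginary parts of a given X j. *)
Definition cindependent (I : choiceType) (J : set I)
    (X : I -> Omega -> R[i]) : Prop :=
  forall (F : {fset I}) (B : I -> set (R * R)),
    [set` F] `<=` J -> (forall j, measurable (B j)) ->
    P (\bigcap_(j in [set` F])
         [set w | B j (complex.Re (X j w), complex.Im (X j w))]) =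
    (\prod_(j <- F) P [set w | B j (complex.Re (X j w), complex.Im (X j w))])%E.

End Probability.

(* Main.v *)
(* The kernel Phi(x) = hbar_n sum_l H(l/n) e^{ilx} satisfies
   |Phi(x)| <= L / (n|x|)^S for |x| <= pi.  Summing S times by parts on the
   grid of step 1/q bounds the sum by q^{1-S} ||H^(S)||_1 / |2 sin(x/2)|^S, up to
   an error O(1/q); replacing |2 sin(x/2)| by |x| without losing a factor
   exponential in S is done by doubling: the trigonometric sum of step 1/q at x
   is half the sum of those of step 1/(2q) at x/2 and x/2 + pi, and
   1/sin(x/2)^2 = (1/sin(x/4)^2 + 1/cos(x/4)^2)/4, so after p doublings
   |2 sin(x/2)| is replaced by 2^{p+1} sin(|x|/2^{p+1}) -> |x| in all but two
   factors.  For the noise, Chernoff bounds for weighted sums of independent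
   sub-Gaussian variables hold simultaneously on a grid of 8n^2 points and for
   the individual noise terms, and the latter control the oscillation between
   grid points.  Off the noise, |sigma_n| is then close to |A_l| near lambda_l and
   small at distance at least C/n from all the lambda_k. *)
Require Import Defs.
From mathcomp Require Import all_boot all_order all_algebra.
From mathcomp Require Import all_classical all_reals all_analysis.
From mathcomp Require Import measurable_realfun.
From mathcomp Require Import finmap ring lra zify.

Set Implicit Arguments.
Unset Strict Implicit.
Unset Printing Implicit Defensive.

Import Order.TTheory GRing.Theory Num.Theory.
Import numFieldNormedType.Exports.

Local Open Scope classical_set_scope.
Local Open Scope ring_scope.

(** * Moduli of complex numbers and unit exponentials *)

Section ComplexModulus.
Context {R : realType}.
Implicit Types (z w : R[i]) (t x y : R).

(** The constants may depend on [H] alone, and the numerical factor in [L] does not grow with S.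
    Hence neither a factor like (pi/2)^S, the price of comparing the chord 2|sin(x/2)| with |x|, nor
    a relative sampling error O(1/n), whose constant involves S and the derivative of order S+1, may
    survive in the decay of the kernel. Refining the grid indefinitely at fixed n disposes of both.
    What remains is a factor 4, from the two sines left aside, and a factor 2, from ||H||_1 <= 2;
    their product 8 is below 14 sqrt(2 pi)/3.

    The rest is a budget in units of m. The constant C satisfies C^S >= 16 M L / m, so all the
    kernels centred at distance at least C/n from x contribute together at most m/16, and the
    condition on the noise grants it another m/16. The level m/2 lies between 2m/16 and what the
    nearest kernel leaves after these two losses. One exceptional event serves for all x at once, so
    the four statements and the localization of the maximizers, which depend on the noise, hold on
    the same event. *)

Lemma cmodD z w : cmod (z + w) <= cmod z + cmod w.
Proof. exact: le_normcD. Qed.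

Lemma cmodN z : cmod (- z) = cmod z.
Proof. exact: normcN. Qed.

Lemma cmod_ge0 z : 0 <= cmod z.
Proof. by case: z => a b; rewrite /= sqrtr_ge0. Qed.

Lemma cmod_sum (I : Type) (r : seq I) (P : pred I) (F : I -> R[i]) :
  cmod (\sum_(i <- r | P i) F i) <= \sum_(i <- r | P i) cmod (F i).
Proof.
elim/big_rec2: _ => [|i y z _ IH]; first by rewrite Normc.normc0.
by rewrite (le_trans (cmodD _ _))// lerD2l.
Qed.

Lemma cmod_ge_Re z : complex.Re z <= cmod z.
Proof.
case: z => a b /=; apply: le_trans (ler_norm a) _.
by rewrite -sqrtr_sqr ler_wsqrtr// lerDl sqr_ge0.
Qed.

Lemma cmod_le_ReIm z : cmod z <= `|complex.Re z| + `|complex.Im z|.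
Proof.
case: z => a b /=; rewrite -[leRHS]ger0_norm ?addr_ge0// -sqrtr_sqr ler_wsqrtr//.
by rewrite sqrrD !real_normK ?num_real// lerD2r lerDl mulrn_wge0// mulr_ge0.
Qed.

Lemma Re_sum (I : Type) (r : seq I) (F : I -> R[i]) :
  complex.Re (\sum_(i <- r) F i) = \sum_(i <- r) complex.Re (F i).
Proof. by elim/big_rec2: _ => // i y z _ <-; case: (F i) z => ? ? []. Qed.

Lemma Im_sum (I : Type) (r : seq I) (F : I -> R[i]) :
  complex.Im (\sum_(i <- r) F i) = \sum_(i <- r) complex.Im (F i).
Proof. by elim/big_rec2: _ => // i y z _ <-; case: (F i) z => ? ? []. Qed.

Lemma Re_mul_real x z : complex.Re (x%:C%C * z) = x * complex.Re z.
Proof. by case: z => c d; rewrite /= mul0r subr0. Qed.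

Lemma Im_mul_real x z : complex.Im (x%:C%C * z) = x * complex.Im z.
Proof. by case: z => c d; rewrite /= mul0r addr0. Qed.

Lemma cmodX z n : cmod (z ^+ n) = cmod z ^+ n.
Proof.
elim: n => [|n IH]; first by rewrite !expr0 Normc.normc1.
by rewrite !exprS Normc.normcM IH.
Qed.

Lemma cmod_real x : cmod x%:C%C = `|x|.
Proof. by rewrite /= expr0n/= addr0 sqrtr_sqr. Qed.

Lemma cmod_expi t : cmod (expi t) = 1.
Proof. by rewrite /= cos2Dsin2 sqrtr1. Qed.

Lemma expiD x y : expi (x + y) = expi x * expi y.
Proof.
by rewrite /expi cosD sinD; apply/eqP; rewrite eq_complex/= eqxx/= addrC.
Qed.

Lemma expi0 : expi (0 : R) = 1.
Proof. by rewrite /expi cos0 sin0. Qed.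

Lemma expi_natl n t : expi (n%:R * t) = expi t ^+ n.
Proof.
elim: n => [|n IH]; first by rewrite mul0r expi0 expr0.
by rewrite -natr1 mulrDl mul1r expiD IH exprSr.
Qed.

Lemma expi_pi : expi (pi : R) = -1.
Proof. by rewrite /expi cospi sinpi; apply/eqP; rewrite eq_complex/= oppr0 !eqxx. Qed.

Lemma expi_2piz (j : int) t : expi (t + j%:~R * (2 * pi)) = expi t.
Proof.
have e2 n : expi (n%:R * (2 * pi) : R) = 1.
  by rewrite expi_natl mulr_natl mulr2n expiD expi_pi mulrNN mulr1 expr1n.
rewrite expiD; suff -> : expi (j%:~R * (2 * pi) : R) = 1 by rewrite mulr1.
case: j => n; first exact: e2.
by rewrite NegzE mulrNz -[LHS]mulr1 -{1}(e2 n.+1) -expiD mulNr addNr expi0.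
Qed.

Lemma cmod_1_expi x : cmod (1 - expi x) = 2 * `|sin (x / 2)|.
Proof.
have -> : x = x / 2 + x / 2 by lra.
have -> : (x / 2 + x / 2) / 2 = x / 2 by lra.
move: (x / 2) => y.
rewrite /= cosD sinD.
have -> : 2 * `|sin y| = `|2 * sin y| by rewrite normrM ger0_norm.
rewrite -[RHS]sqrtr_sqr; congr Num.sqrt.
have := cos2Dsin2 y; move: (cos y) (sin y) => c s cs.
apply/eqP; rewrite -subr_eq0; apply/eqP.
by transitivity ((c ^+ 2 + s ^+ 2 - 1) ^+ 2); [ring | rewrite cs subrr expr0n].
Qed.

End ComplexModulus.

(** * Summation by parts for sampled functions *)

Section SummationByParts.
Context {R : realType}.
Implicit Types (g : R -> R) (h : R) (z : R[i]).

Definition bdiff h g : R -> R := fun t => g t - g (t - h).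

(** With h = 1/q the index m stands for the frequency m - q: up to the unimodular factor z^q this is
    the exponential sum with weights g(l/q), written as a polynomial in z so that it can be
    multiplied by 1 - z. *)
Definition grid_sum g h N z : R[i] :=
  \sum_(m < N) (g (m%:R * h - 1))%:C%C * z ^+ m.

Lemma bdiff_left0 h g : 0 <= h -> (forall t, t <= -1 -> g t = 0) ->
  forall t, t <= -1 -> bdiff h g t = 0.
Proof. by move=> h0 g0 t t1; rewrite /bdiff !g0 ?subrr//; lra. Qed.

(** Multiplication by 1 - z replaces each coefficient by its difference with the preceding one. Both
    boundary terms drop: g vanishes at the first node -1 and at the last node. *)
Lemma grid_sum_bdiff g h N z : 0 <= h ->
  (forall t, t <= -1 -> g t = 0) -> g (N%:R * h - 1) = 0 ->
  (1 - z) * grid_sum g h N.+1 z = grid_sum (bdiff h g) h N.+1 z.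
Proof.
move=> h0 g0 gN; rewrite /grid_sum mulrBl mul1r mulr_sumr.
under [RHS]eq_bigr => m _ do rewrite /bdiff rmorphB mulrBl.
rewrite sumrB; congr (_ - _).
rewrite big_ord_recr/= gN mul0r mulr0 addr0 [RHS]big_ord_recl/=.
rewrite g0; last by lra.
rewrite mul0r add0r; apply: eq_bigr => m _.
rewrite /bump/= add1n exprS mulrCA.
have -> : m.+1%:R * h - 1 - h = m%:R * h - 1 by rewrite -natr1; ring.
by [].
Qed.

(** Each backward difference pushes the support to the right by h and leaves its left end in place;
    this is why S nodes are added on the right of the grid before S summations by parts. *)
Lemma bdiff_right0 h g k : 0 <= h -> (forall t, 1 <= t -> g t = 0) ->
  forall t, 1 + k%:R * h <= t -> iter k (bdiff h) g t = 0.
Proof.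
move=> h0 g0; elim: k => [|k IH] t; first by rewrite mul0r addr0; exact: g0.
rewrite -natr1 => kt /=; rewrite /bdiff !IH ?subrr//; lra.
Qed.

Lemma grid_sum_iter_bdiff g q S z : (0 < q)%N ->
  (forall t, t <= -1 -> g t = 0) -> (forall t, 1 <= t -> g t = 0) ->
  (1 - z) ^+ S * grid_sum g q%:R^-1 (2 * q + S).+1 z =
  grid_sum (iter S (bdiff q%:R^-1) g) q%:R^-1 (2 * q + S).+1 z.
Proof.
move=> q0 gl gr; have h0 : 0 <= q%:R^-1 :> R by rewrite invr_ge0.
suff : forall k, (k <= S)%N -> (1 - z) ^+ k * grid_sum g q%:R^-1 (2 * q + S).+1 z =
  grid_sum (iter k (bdiff q%:R^-1) g) q%:R^-1 (2 * q + S).+1 z by exact.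
elim=> [_|k IH kS]; first by rewrite expr0 mul1r.
rewrite exprS -mulrA IH ?(ltnW kS)//= grid_sum_bdiff//.
- by elim: (k) => //= k' IH'; exact: bdiff_left0.
- apply: bdiff_right0 => //; rewrite natrD natrM mulrDl mulfK ?pnatr_eq0 ?lt0n_neq0//.
  have : k%:R * q%:R^-1 <= S%:R * q%:R^-1 :> R by rewrite ler_wpM2r// ler_nat ltnW.
  lra.
Qed.

End SummationByParts.

(** * Finite differences and Riemann sums of smooth functions *)

Section SmoothSampling.
Context {R : realType}.
Implicit Types (f g : R -> R) (h t : R).

Lemma derivative_continuous f g :
  (forall t : R, is_derive t 1 f (g t)) -> continuous f.
Proof.
move=> fg t; apply/differentiable_continuous/derivable1_diffP.
by have [] := fg t.
Qed.

Lemma continuous_itv f (a b : R) : continuous f -> {within `[a, b], continuous f}.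
Proof. by move=> cf; apply: continuous_subspaceT. Qed.

Lemma increment_le f g (B t u : R) : (forall t : R, is_derive t 1 f (g t)) ->
  (forall x, t <= x <= u -> `|g x| <= B) -> t <= u ->
  `|f u - f t| <= B * (u - t).
Proof.
move=> fg gB tu.
have cf : {within `[t, u], continuous f}.
  by apply: continuous_itv; exact: derivative_continuous fg.
have [c] := MVT_segment (f := f) (df := g) tu (fun x _ => fg x) cf.
 rewrite in_itv/= => cab ->.
by rewrite normrM (ger0_norm (x := u - t)) ?subr_ge0// ler_wpM2r ?subr_ge0// gB.
Qed.

Lemma lipschitz_of_derivative f g (B : R) : (forall t : R, is_derive t 1 f (g t)) ->
  (forall x, `|g x| <= B) -> forall t u, `|f u - f t| <= B * `|u - t|.
Proof.
move=> fg gB t u; have [tu|/ltW ut] := leP t u.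
  by rewrite (ger0_norm (x := u - t)) ?subr_ge0// (increment_le fg).
by rewrite distrC (distrC u) (ger0_norm (x := t - u)) ?subr_ge0// (increment_le fg).
Qed.

(** The mean value theorem, k times. The whole chain of derivatives is part of the induction: the
    step passes to the chain [bdiff h (f j)], whose member of index k is bounded by h B. *)
Lemma iter_bdiff_le h k (f : nat -> R -> R) t (B : R) : 0 <= h ->
  (forall j (x : R), is_derive x 1 (f j) (f j.+1 x)) ->
  (forall x, t - k%:R * h <= x <= t -> `|f k x| <= B) ->
  `|iter k (bdiff h) (f 0%N) t| <= h ^+ k * B.
Proof.
move=> h0; elim: k f t B => [|k IH] f t B df fB.
  by rewrite expr0 mul1r fB// mul0r subr0 lexx.
rewrite iterSr exprSr -mulrA.
apply: (IH (fun j => bdiff h (f j))) => [j x|x /andP[x1 x2]].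
  have dsh : is_derive (x - h) 1 (f j) (f j.+1 (x - h)) by exact: df.
  have dx : is_derive x (1 : R) (fun y : R => y - h) 1.
    by apply: is_derive_eq; rewrite subr0.
  have := @is_derive1_comp R (f j) (fun y => y - h) x _ _ dsh dx.
  rewrite mulr1 => dc; rewrite /bdiff; apply: is_deriveB.
have := @increment_le (f k) (f k.+1) B (x - h) x (df k).
have -> : x - (x - h) = h by ring.
rewrite [B * h]mulrC; apply; last by lra.
by move=> y /andP[y1 y2]; apply: fB; rewrite -natr1; lra.
Qed.

Lemma integrable_cc f (a b : R) : continuous f ->
  lebesgue_measure.-integrable `[a, b] (EFin \o f).
Proof.
move=> cf; apply: continuous_compact_integrable; first exact: segment_compact.
exact: continuous_itv.
Qed.

Lemma integrable_oc f (a b : R) : continuous f ->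
  lebesgue_measure.-integrable `]a, b] (EFin \o f).
Proof.
move=> cf; apply: integrableS (integrable_cc a b cf) => //.
by apply: subset_itvr; rewrite bnd_simp.
Qed.

Lemma continuous_normr f : continuous f -> continuous (fun t => `|f t|).
Proof.
by move=> cf t; apply: (continuous_comp (cf t)); exact: norm_continuous.
Qed.

(** On the cell following a node b, |g| is at least |g(b)| - B h, so each cell of length h loses at
    most B h^2. *)
Lemma riemann_sum_le g (B h : R) N : 0 <= h -> continuous g -> 0 <= B ->
  (forall t u, `|g u - g t| <= B * `|u - t|) ->
  \sum_(m < N) h * `|g (m%:R * h - 1)| <=
  \int[lebesgue_measure]_(t in `[-1, N%:R * h - 1]) `|g t| + N%:R * (B * h ^+ 2).
Proof.
move=> h0 cg B0 gB.
have cag := continuous_normr cg.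
elim: N => [|N IH].
  by rewrite big_ord0 !mul0r addr0 Rintegral_ge0.
rewrite big_ord_recr/= -!natr1 !mulrDl !mul1r.
set b := N%:R * h - 1 in IH *.
have -> : N%:R * h + h - 1 = b + h by rewrite /b; ring.
have b1 : -1 <= b by rewrite /b lerBrDr addNr mulr_ge0.
have := @Rintegral_itvB _ (fun t => `|g t|) (BLeft (-1)) (BRight (b + h)) b (integrable_cc _ _ cag).
rewrite !bnd_simp lerDl => /(_ b1 h0) eqI.
have : h * (`|g b| - B * h) <= \int[lebesgue_measure]_(x in `]b, (b + h)]) `|g x|.
  have -> : h * (`|g b| - B * h) =
      \int[lebesgue_measure]_(x in `]b, (b + h)]) (`|g b| - B * h).
    rewrite Rintegral_cst//= lebesgue_measure_itv/= lte_fin ltrDl.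
    case: ltgtP h0 => // [h0 _|<- _]; last by rewrite mul0r mulr0.
    by rewrite /= addrAC subrr add0r mulrC.
  apply: le_Rintegral => //.
  - by apply: integrable_oc; exact: cst_continuous.
  - exact: integrable_oc.
  - move=> x /=; rewrite in_itv/= => /andP[x1 x2].
    have := gB x b; have := ler_distD 0 (g b) (g x).
    have : B * `|b - x| <= B * h by rewrite ler_wpM2l// distrC ger0_norm; lra.
    have := lerB_dist (g b) (g x); lra.
move: eqI IH; rewrite expr2; lra.
Qed.

End SmoothSampling.

(** * Elementary bounds for sine and cosine *)

Section TrigonometricBounds.
Context {R : realType}.
Implicit Types x u : R.

Lemma sin_lipschitz x u : `|sin u - sin x| <= `|u - x|.
Proof.
rewrite -[leRHS]mul1r; apply: (lipschitz_of_derivative (g := cos)) => t.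
by rewrite ler_norml cos_le1 cos_geN1.
Qed.

Lemma cos_lipschitz x u : `|cos u - cos x| <= `|u - x|.
Proof.
rewrite -[leRHS]mul1r.
apply: (lipschitz_of_derivative (g := fun x => - sin x)) => t.
by rewrite normrN ler_norml sin_le1 sin_geN1.
Qed.

Lemma cos_ge_quadratic u : 1 - u ^+ 2 / 2 <= cos u.
Proof.
have us : u = u / 2 + u / 2 by lra.
have := sin_lipschitz 0 (u / 2); rewrite sin0 !subr0 => su.
have : `|sin (u / 2)| ^+ 2 <= `|u / 2| ^+ 2 by rewrite lerXn2r// nnegrE.
rewrite !real_normK ?num_real// [in cos u]us cosD.
by have := cos2Dsin2 (u / 2); lra.
Qed.

Lemma sin_ge_mul_cos u : 0 <= u <= pi -> u * cos u <= sin u.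
Proof.
move=> /andP[u0 upi].
have cs : {within `[0, u], continuous (@sin R)}.
  by apply: continuous_itv; exact: continuous_sin.
have [c] := MVT_segment u0 (fun x _ => is_derive_sin x) cs.
rewrite in_itv/= sin0 !subr0 => /andP[c0 cu] ->; rewrite mulrC ler_wpM2r//.
by rewrite leNgt ltr_cos ?in_itv/= -?leNgt// ?u0 ?upi ?c0// (le_trans cu).
Qed.

(** With u = 2v, sin u = 2 sin v cos v >= 2 v cos^2 v = v (1 + cos u) >= v. *)
Lemma sin_ge_half u : 0 <= u <= pi / 2 -> u / 2 <= sin u.
Proof.
move=> /andP[u0 u2]; have := @pi_gt0 R => pi0.
have [v uv] : exists v, u = v + v by exists (u / 2); lra.
have c2 : 0 <= cos u by apply: cos_ge0_pihalf; lra.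
have c1 : 0 <= cos v by apply: cos_ge0_pihalf; lra.
have v0 : 0 <= v by lra.
have : v * cos v <= sin v by apply: sin_ge_mul_cos; lra.
move: c2; rewrite uv cosD sinD.
by have := cos2Dsin2 v; nra.
Qed.

End TrigonometricBounds.

(** * Derivatives and norm of a low pass filter *)

Section LowPass.
Context {R : realType}.
Variable H : R -> R.
Hypothesis hH : low_pass_filter H.
Implicit Types (t : R) (k : nat).

Let H01 t : 0 <= H t <= 1. Proof. by case: hH. Qed.

Lemma is_derive_low_pass k t :
  is_derive t 1 (derive1n k H) (derive1n k.+1 H t).
Proof.
have [dH _ _ _ _] := hH.
by apply: DeriveDef; [exact: dH|rewrite derive1nS derive1E].
Qed.

Lemma continuous_low_pass k : continuous (derive1n k H).
Proof. exact: derivative_continuous (is_derive_low_pass k). Qed.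

(** The endpoints 1 and -1 are included: there the derivative is computed as a one-sided limit, from
    the side on which the preceding derivative vanishes identically. *)
Lemma low_pass_eq0 k t : 1 <= `|t| -> derive1n k H t = 0.
Proof.
elim: k t => [|k IH] t t1; first by have [_ _ _ _] := hH; rewrite derive1n0; exact.
have [dH _ _ _ _] := hH.
have df := dH k t; rewrite derive1nS derive1E.
have [t0|t0] := leP 0 t.
- rewrite ['D_1 _ t]cvg_at_rightE//.
  apply: lim_near_cst; first exact: Rhausdorff.
  near=> h; rewrite /= (IH t)// IH ?subrr ?scaler0//.
  have h0 : 0 < h by near: h; exact: nbhs_right_gt.
  by move: t1; rewrite !ger0_norm// ?[_ *: _]mulr1; lra.
- rewrite ['D_1 _ t]cvg_at_leftE//.
  apply: lim_near_cst; first exact: Rhausdorff.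
  near=> h; rewrite /= (IH t)// IH ?subrr ?scaler0//.
  have h0 : h < 0 by near: h; exact: nbhs_left_lt.
  by move: t1; rewrite !ltr0_norm// ?[_ *: _]mulr1; lra.
Unshelve. all: by end_near. Qed.

Lemma low_pass_supp t : 1 <= `|t| -> H t = 0.
Proof. exact: (@low_pass_eq0 0%N). Qed.

Lemma low_pass_bounded k : exists2 B : R, 0 <= B & forall t, `|derive1n k H t| <= B.
Proof.
have cH : {within `[-1, 1], continuous (fun t => `|derive1n k H t|)}.
  exact/continuous_itv/continuous_normr/continuous_low_pass.
have [|c _ cP] := EVT_max _ cH; first by lra.
exists `|derive1n k H c| => // t.
have [t1|t1] := leP `|t| 1; first by apply: cP; rewrite in_itv/= -ler_norml.
by rewrite (low_pass_eq0 _ (ltW t1)) normr0.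
Qed.

(** [H] is 1 on an interval of length 1 and at most 1 on one of length 2. The upper bound is what
    lets ||H||_1 enter the denominator of [L], at the cost of a factor 2. *)
Lemma norm1_low_pass : 1 <= norm1 H <= 2.
Proof.
have [_ _ _ H1 _] := hH.
have cH : continuous (fun t => `|H t|) by exact: continuous_normr (@continuous_low_pass 0%N).
apply/andP; split; last first.
  have I0 : \int[lebesgue_measure]_(t in `[(-1 : R), 1]) (1 : R) = 2.
    rewrite Rintegral_cst//= lebesgue_measure_itv/= lte_fin ifT; last by lra.
    by rewrite /=; lra.
  rewrite -[leRHS]I0; apply: le_Rintegral => //; first exact: integrable_cc.
    by apply: integrable_cc; exact: cst_continuous.
  by move=> t _; have := H01 t; rewrite ler_norml; lra.
have I1 := @Rintegral_itvB _ _ (BLeft (-1 : R)) (BRight 1) (- 2^-1) (integrable_cc _ _ cH).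
have I2 := @Rintegral_itvB _ _ (BRight (- 2^-1 : R)) (BRight 1) (2^-1) (integrable_oc _ _ cH).
have {}I1 := I1 ltac:(by rewrite bnd_simp; lra) ltac:(by rewrite bnd_simp; lra).
have {}I2 := I2 ltac:(by rewrite bnd_simp; lra) ltac:(by rewrite bnd_simp; lra).
have P1 : 0 <= \int[lebesgue_measure]_(t in `[-1, (- 2^-1)]) `|H t| by exact: Rintegral_ge0.
have P2 : 0 <= \int[lebesgue_measure]_(t in `]2^-1, 1]) `|H t| by exact: Rintegral_ge0.
suff : 1 <= \int[lebesgue_measure]_(t in `]-2^-1, 2^-1]) `|H t|.
  by rewrite /norm1; move: I1 I2 P1 P2 => /=; lra.
have I3 : \int[lebesgue_measure]_(t in `]- 2^-1, (2^-1 : R)]) (1 : R) = 1.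
  rewrite Rintegral_cst//= lebesgue_measure_itv/= lte_fin ifT; last by lra.
  by rewrite /=; lra.
rewrite -[leLHS]I3; apply: le_Rintegral => //; last 2 first.
  exact: integrable_oc.
  move=> t /=; rewrite in_itv/= => /andP[t1 t2].
  by rewrite H1 ?normr1// ler_norml; lra.
by apply: integrable_oc; exact: cst_continuous.
Qed.

End LowPass.

(** * Decay of the exponential sums by summation by parts and doubling *)

Section KernelDecay.
Context {R : realType}.
Variable H : R -> R.
Hypothesis hH : low_pass_filter H.
Implicit Types (x a : R) (q S p : nat).

Lemma grid_sum_widen q N z : (0 < q)%N -> (2 * q <= N)%N ->
  grid_sum H q%:R^-1 N z = grid_sum H q%:R^-1 (2 * q) z.
Proof.
move=> q0 /subnKC <-; elim: (N - _)%N => [|k IH]; first by rewrite addn0.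
rewrite addnS /grid_sum big_ord_recr/= -/(grid_sum _ _ _ _) IH.
rewrite (low_pass_supp hH) ?mul0r ?addr0//.
rewrite natrD natrM mulrDl mulfK ?pnatr_eq0 ?lt0n_neq0//.
have k0 : 0 <= k%:R * q%:R^-1 :> R by rewrite mulr_ge0.
by rewrite ger0_norm; lra.
Qed.

Lemma sum_iter_bdiff_le S : exists2 c : R, 0 <= c & forall q, (0 < q)%N ->
  q%:R^-1 * (\sum_(m < (2 * q + S).+1) `|iter S (bdiff q%:R^-1) H (m%:R * q%:R^-1 - 1)|)
  <= q%:R^-1 ^+ S * (norm1 (derive1n S H) + c * q%:R^-1).
Proof.
have [B B0 HB] := low_pass_bounded hH S.+1.
(* The Riemann sum over 2q cells costs 2 B h. Evaluating the derivative at the node instead of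
   within S h of it costs B S h at each of the 2q + S + 1 nodes, and (2q + S + 1) h <= S + 3. *)
exists (B * (2 + (S%:R + 3) * S%:R)) => [|q q0].
  by rewrite mulr_ge0// addr_ge0// mulr_ge0// addr_ge0.
set h := q%:R^-1; set g := derive1n S H.
have h0 : 0 < h by rewrite invr_gt0 ltr0n.
have h1 : h <= 1 by rewrite invf_le1 ?ler1n// ltr0n.
have qh : q%:R * h = 1 by rewrite mulfV ?pnatr_eq0 ?lt0n_neq0.
have g0 t : 1 <= `|t| -> g t = 0 by exact: low_pass_eq0.
have lip : forall t u, `|g u - g t| <= B * `|u - t|.
  exact: lipschitz_of_derivative (is_derive_low_pass hH S) HB.
have pt t : `|iter S (bdiff h) H t| <= h ^+ S * (`|g t| + B * (S%:R * h)).
  apply: (iter_bdiff_le (f := fun k => derive1n k H)) => [|j x|x /andP[x1 x2]].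
  - exact: ltW.
  - exact: is_derive_low_pass.
  - have := lip t x; have := lerB_dist (g x) (g t).
    have : B * `|x - t| <= B * (S%:R * h).
      by rewrite ler_wpM2l// distrC ger0_norm; lra.
    by rewrite -/g; lra.
have sumg : \sum_(m < (2 * q + S).+1) h * `|g (m%:R * h - 1)| <=
    norm1 g + 2 * (B * h).
  rewrite (_ : \sum_(_ < _) _ = \sum_(m < 2 * q) h * `|g (m%:R * h - 1)|); last first.
    rewrite -addnS; elim: S.+1 => [|k IH]; first by rewrite addn0.
    rewrite addnS big_ord_recr/= IH g0 ?normr0 ?mulr0 ?addr0//.
    rewrite natrD natrM mulrDl -mulrA qh.
    have k0 : 0 <= k%:R * h by rewrite mulr_ge0// ltW.
    by rewrite ger0_norm; lra.
  apply: le_trans (riemann_sum_le (2 * q) (ltW h0) (@continuous_low_pass _ _ hH S) B0 lip) _.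
  rewrite natrM -mulrA qh mulr1 (_ : 2 - 1 = 1); last by lra.
  rewrite /norm1 lerD2l -!mulrA ler_wpM2l// expr2 (mulrCA B) (mulrA q%:R) qh mul1r.
  by rewrite lexx.
rewrite mulr_sumr; apply: (@le_trans _ _ (\sum_(m < (2 * q + S).+1)
    (h ^+ S * (h * `|g (m%:R * h - 1)|) + h ^+ S * (h * (B * (S%:R * h)))))).
  apply: ler_sum => m _; rewrite -mulrDr -mulrDr mulrCA.
  by rewrite ler_wpM2l// ltW.
rewrite big_split/= -mulr_sumr sumr_const card_ord -mulrnAr -mulrDr.
rewrite ler_wpM2l ?exprn_ge0 ?(ltW h0)//.
apply: le_trans (lerD sumg (lexx _)) _.
rewrite -addrA lerD2l -(mulr_natl _ (2 * q + S).+1) -(natr1 (2 * q + S)%N) natrD natrM.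
have -> : (2 * q%:R + S%:R + 1) * (h * (B * (S%:R * h))) =
   (2 * (q%:R * h) + (S%:R + 1) * h) * (B * S%:R * h) by ring.
rewrite qh mulr1.
have : (S%:R + 1) * h <= S%:R + 1 by rewrite ger_pMr.
have : 0 <= B * S%:R * h by rewrite !mulr_ge0// ltW.
set u := B * S%:R * h; set v := (S%:R + 1) * h => u0 vS.
have -> : B * (2 + (S%:R + 3) * S%:R) * h = 2 * (B * h) + (S%:R + 3) * u by rewrite /u; ring.
nra.
Qed.

Let A q x := q%:R^-1 * cmod (grid_sum H q%:R^-1 (2 * q) (expi x)).

Lemma grid_sum_le0 S : exists2 c : R, 0 <= c & forall q x, (0 < q)%N ->
  A q x * (2 * `|sin (x / 2)|) ^+ S <=
  q%:R^-1 ^+ S * (norm1 (derive1n S H) + c * q%:R^-1).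
Proof.
have [c c0 cP] := sum_iter_bdiff_le S; exists c => // q x q0.
apply: le_trans (cP q q0); rewrite -mulrA ler_wpM2l//.
rewrite -cmod_1_expi -cmodX mulrC -Normc.normcM.
rewrite -(@grid_sum_widen q (2 * q + S).+1)//; last by lia.
rewrite grid_sum_iter_bdiff//; last 2 first.
- by move=> t t1; rewrite (low_pass_supp hH)// ler0_norm; lra.
- by move=> t t1; rewrite (low_pass_supp hH)// ger0_norm; lra.
apply: le_trans (cmod_sum _ _ _) _; apply: ler_sum => m _.
by rewrite Normc.normcM cmod_real cmodX cmod_expi expr1n mulr1.
Qed.

Lemma big_ord_double (V : nmodType) N (F : nat -> V) :
  \sum_(m < 2 * N) F m = \sum_(m < N) (F (2 * m)%N + F (2 * m).+1).
Proof.
elim: N => [|N IH]; first by rewrite !big_ord0.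
by rewrite (_ : 2 * N.+1 = (2 * N).+2)%N ?mulnS// !big_ord_recr/= IH addrA.
Qed.

(* Only the even powers survive in [T_(2q)(w) + T_(2q)(-w)], and they form
   [T_q(w^2)]; here [w = expi (x / 2)]. *)
Lemma grid_sum_double q x : (0 < q)%N -> A q x <= A (2 * q) (x / 2) + A (2 * q) (x / 2 + pi).
Proof.
move=> q0; rewrite /A -mulrDr natrM invfM mulrAC.
have -> : 2^-1 * (cmod (grid_sum H (2^-1 * q%:R^-1) (2 * (2 * q)) (expi (x / 2))) +
    cmod (grid_sum H (2^-1 * q%:R^-1) (2 * (2 * q)) (expi (x / 2 + pi)))) * q%:R^-1 =
  q%:R^-1 * (2^-1 * (cmod (grid_sum H (2^-1 * q%:R^-1) (2 * (2 * q)) (expi (x / 2))) +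
    cmod (grid_sum H (2^-1 * q%:R^-1) (2 * (2 * q)) (expi (x / 2 + pi))))).
  by rewrite mulrC.
rewrite ler_wpM2l// ler_pdivlMl//.
apply: le_trans (cmodD _ _).
rewrite [X in X * _ <= _](_ : 2 = cmod (2 : R)%:C%C); last by rewrite cmod_real ger0_norm.
rewrite -Normc.normcM le_eqVlt; apply/orP; left; apply/eqP; congr cmod.
pose F z m : R[i] := (H (m%:R * (2^-1 * q%:R^-1) - 1))%:C%C * z ^+ m.
have dbl z : grid_sum H (2^-1 * q%:R^-1) (2 * (2 * q)) z =
  \sum_(m < 2 * q) (F z (2 * m)%N + F z (2 * m).+1) := big_ord_double (2 * q) (F z).
rewrite !dbl /F -big_split /grid_sum mulr_sumr; apply: eq_bigr => m _ /=.
rewrite expiD expi_pi mulrN1 [in RHS](exprS (- _)) [in RHS](exprS (expi (x / 2))).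
rewrite !(exprM _ 2) sqrrN -[X in _ * (_ * X ^+ m) = _]/(expi x).
have -> : expi (x / 2) ^+ 2 = expi x.
  by rewrite -expi_natl mulrC divfK.
rewrite natrM (_ : 2 * m%:R * (2^-1 * q%:R^-1) = m%:R / q%:R :> R); last first.
  by rewrite mulrACA mulfV ?mul1r// pnatr_eq0.
rewrite mulNr mulrN addrACA subrr addr0 rmorph_nat.
by rewrite [LHS]mulr_natl mulr2n.
Qed.

Lemma sin_ge_sin a x : 0 <= a -> a <= x <= pi - a -> sin a <= sin x.
Proof.
move=> a0 /andP[ax xa]; rewrite -(cosBpihalf a) -(cosBpihalf x) -cosN.
have cos_le (u v : R) : 0 <= u -> u <= v -> v <= pi -> cos v <= cos u.
  move=> u0 uv vp; rewrite leNgt ltr_cos ?in_itv/= -?leNgt// ?u0 ?vp ?andbT//.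
    exact: le_trans uv.
  exact: le_trans vp.
have [xp|/ltW xp] := leP x (pi / 2); last by apply: cos_le; lra.
by rewrite -(cosN (x - _)); apply: cos_le; lra.
Qed.

(* [norm1 _ + c / q] is the bound at step [1 / q]; it is only used on the
   finest grid, of step [1 / (q 2^p)], so the error term vanishes as [p] grows. *)
Lemma decay_iter s c p q x a :
  (forall q x, (0 < q)%N -> A q x * (2 * `|sin (x / 2)|) ^+ s.+2 <=
    q%:R^-1 ^+ s.+2 * (norm1 (derive1n s.+2 H) + c * q%:R^-1)) ->
  (0 < q)%N -> 0 < a -> a <= x <= 2 * pi - a ->
  A q x * (4 * sin (x / 2) ^+ 2) * (2 ^+ p.+1 * sin (a / 2 ^+ p.+1)) ^+ s <=
  q%:R^-1 ^+ s.+2 * (norm1 (derive1n s.+2 H) + c * (q%:R^-1 / 2 ^+ p)).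
Proof.
move=> base; have A0 q' x' : 0 <= A q' x' by rewrite mulr_ge0// cmod_ge0.
elim: p q x a => [|p IH] q x a q0 a0 /andP[ax xa].
  rewrite expr0 divr1 expr1; apply: le_trans (base q x q0).
  have sa : 0 <= sin (a / 2) by apply: sin_ge0_pi; lra.
  have sax : sin (a / 2) <= sin (x / 2) by apply: sin_ge_sin; lra.
  have sx : 0 <= sin (x / 2) by exact: le_trans sax.
  rewrite ger0_norm// -(addn2 s) exprD -mulrA ler_wpM2l// mulrC.
  rewrite (_ : (2 * sin (x / 2)) ^+ 2 = 4 * sin (x / 2) ^+ 2); last by ring.
  apply: ler_wpM2r; first by rewrite mulr_ge0// sqr_ge0.
  by apply: lerXn2r; rewrite ?nnegrE ?mulr_ge0// ler_wpM2l.
have q2 : (0 < 2 * q)%N by rewrite muln_gt0.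
have a2 : 0 < a / 2 by rewrite divr_gt0.
have x2 : x / 2 = x / 2 / 2 + x / 2 / 2 by rewrite -splitr.
have x3 : (x / 2 + pi) / 2 = x / 2 / 2 + pi / 2 by rewrite mulrDl.
(* The parameter a bounds the distance of x to the multiples of 2 pi from below. Both x/2 and x/2 +
   pi inherit the bound a/2, although x/2 + pi itself is not small; hence a is kept apart from x. *)
have IH1 := IH (2 * q)%N (x / 2) (a / 2) q2 a2 ltac:(lra).
have IH2 := IH (2 * q)%N (x / 2 + pi) (a / 2) q2 a2 ltac:(lra).
have r_eq : 2 ^+ p.+2 * sin (a / 2 ^+ p.+2) =
    2 * (2 ^+ p.+1 * sin (a / 2 / 2 ^+ p.+1)).
  by rewrite (exprS _ p.+1) invfM !mulrA.
move: IH1 IH2; rewrite r_eq x3 sinDpihalf.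
rewrite (_ : sin (x / 2) = 2 * (sin (x / 2 / 2) * cos (x / 2 / 2))); last first.
  by rewrite [in LHS]x2 sinD; ring.
have := grid_sum_double x q0.
have : 0 <= 2 ^+ p.+1 * sin (a / 2 / 2 ^+ p.+1).
  rewrite mulr_ge0 ?exprn_ge0// sin_ge0_pi// divr_ge0 ?(ltW a2) ?exprn_ge0//=.
  rewrite ler_pdivrMr ?exprn_gt0//.
  have : 1 <= 2 ^+ p.+1 :> R by rewrite exprn_ege1// ler1n.
  have := @pi_gt0 R; nra.
have := A0 (2 * q)%N (x / 2); have := A0 (2 * q)%N (x / 2 + pi); have := A0 q x.
have := cos2Dsin2 (x / 2 / 2).
have -> : q%:R^-1 = 2 * (2 * q)%:R^-1 :> R.
  by rewrite natrM invfM mulrA divff ?mul1r.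
have -> : 2 * (2 * q)%:R^-1 / 2 ^+ p.+1 = (2 * q)%:R^-1 / 2 ^+ p :> R.
  by rewrite exprS invfM mulrACA divff ?mul1r.
move: (A q x) (A (2 * q)%N (x / 2)) (A (2 * q)%N (x / 2 + pi)) => u u1 u2.
move: (sin (x / 2 / 2)) (cos (x / 2 / 2)) (2 ^+ p.+1 * sin _) => sx cx r.
set B := _ * (norm1 _ + _) => cs u0 u20 u10 r0 uu I1 I2.
(* Of the factor 2^(s+2) gained by halving the step, 2^s pays for replacing r by 2r in r^s, and 4
   pays for the double angle formula in the remaining two sines. *)
have -> : (2 * (2 * q)%:R^-1) ^+ s.+2 *
  (norm1 (derive1n s.+2 H) + c * ((2 * q)%:R^-1 / 2 ^+ p)) = 2 ^+ s * (4 * B).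
  by rewrite /B exprMn -(addn2 s) !exprD; ring.
rewrite [(2 * r) ^+ s]exprMn; set w := (4 * (2 * (sx * cx)) ^+ 2) * r ^+ s.
have w0 : 0 <= w by rewrite mulr_ge0 ?exprn_ge0// mulr_ge0// sqr_ge0.
rewrite (_ : u * _ * _ = 2 ^+ s * (u * w)); last by rewrite /w; ring.
rewrite ler_wpM2l ?exprn_ge0//; apply: le_trans (ler_wpM2r w0 uu) _.
rewrite (_ : (u1 + u2) * w = 4 * cx ^+ 2 * (u1 * (4 * sx ^+ 2) * r ^+ s) +
   4 * sx ^+ 2 * (u2 * (4 * cx ^+ 2) * r ^+ s)); last by rewrite /w; ring.
have c2 : 0 <= 4 * cx ^+ 2 by rewrite mulr_ge0// sqr_ge0.
have s2 : 0 <= 4 * sx ^+ 2 by rewrite mulr_ge0// sqr_ge0.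
apply: le_trans (lerD (ler_wpM2l c2 I1) (ler_wpM2l s2 I2)) _.
by rewrite -mulrDl -mulrDr cs mulr1.
Qed.

(** This is the limit of [decay_iter] with a = x as p grows. Only the two sines kept aside are
    compared crudely, by 4 sin^2(x/2) >= x^2/4; this gives the factor 4 whatever s is. *)
Lemma kernel_decay s q x : (0 < q)%N -> 0 < x <= pi ->
  A q x * x ^+ s.+2 <= 4 * (q%:R^-1 ^+ s.+2 * norm1 (derive1n s.+2 H)).
Proof.
move=> q0 /andP[x0 xpi]; have [c c0 base] := grid_sum_le0 s.+2.
have A0 : 0 <= A q x by rewrite mulr_ge0// cmod_ge0.
set X := A q x * (4 * sin (x / 2) ^+ 2).
set Q := q%:R^-1 ^+ s.+2; set N1 := norm1 _.
have X0 : 0 <= X by rewrite mulr_ge0// mulr_ge0// sqr_ge0.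
suff XN : X * x ^+ s <= Q * N1.
  have sx : x / 2 / 2 <= sin (x / 2) by apply: sin_ge_half; lra.
  have : (x / 2 / 2) ^+ 2 <= sin (x / 2) ^+ 2.
    by apply: lerXn2r => //; rewrite nnegrE; [lra|apply: le_trans sx; lra].
  have xs : 0 <= x ^+ s by rewrite exprn_ge0// ltW.
  move=> sx2; have := ler_wpM2l (mulr_ge0 A0 xs) sx2.
  move: XN; rewrite /X -(addn2 s) exprD; move: (sin _ ^+ 2) (x ^+ s) (A q x) => *.
  nra.
have xx : x <= x <= 2 * pi - x by rewrite lexx; lra.
have key p : x ^+ 2 / 2 ^+ p <= 1 ->
    X * x ^+ s <= Q * N1 + (Q * c * q%:R^-1 + X * x ^+ s * s%:R * x ^+ 2) / 2 ^+ p.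
  move=> e1; have := decay_iter p base q0 x0 xx.
  rewrite -/X -/Q -/N1; set e := x ^+ 2 / 2 ^+ p in e1 *.
  have P1 : 1 <= 2 ^+ p :> R by rewrite exprn_ege1// ler1n.
  have p0 : 0 < 2 ^+ p :> R by exact: lt_le_trans P1.
  have p10 : 0 < 2 ^+ p.+1 :> R by rewrite exprn_gt0.
  set u := x / 2 ^+ p.+1.
  have u0 : 0 <= u by rewrite divr_ge0 ?ltW.
  have ux : 2 ^+ p.+1 * u = x by rewrite /u mulrC divfK// gt_eqF.
  have upi : u <= pi.
    have : 1 * u <= 2 ^+ p.+1 * u by rewrite ler_wpM2r// exprn_ege1// ler1n.
    by rewrite ux; lra.
  have ue : u ^+ 2 / 2 <= e.
    rewrite /e ler_pdivlMr// -ux [leRHS]exprMn [2 ^+ p.+1]exprS.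
    have : 0 <= u ^+ 2 * 2 ^+ p by rewrite mulr_ge0 ?sqr_ge0// ltW.
    move: (u ^+ 2) (2 ^+ p) P1 => v P P1' vP.
    have := mulr_ge0 vP (_ : 0 <= P - 1); rewrite subr_ge0 => /(_ P1').
    lra.
  have e0 : 0 <= e by rewrite divr_ge0 ?sqr_ge0// ltW.
  have rx : x * (1 - e) <= 2 ^+ p.+1 * sin u.
    apply: (@le_trans _ _ (2 ^+ p.+1 * (u * cos u))).
      rewrite mulrA ux ler_wpM2l ?(ltW x0)//.
      by apply: le_trans (cos_ge_quadratic u); lra.
    apply: ler_wpM2l; first exact: ltW.
    by apply: sin_ge_mul_cos; rewrite u0.
  (* Bernoulli's inequality makes the loss in the power s linear in e, hence O(2^-p) for fixed s. *)
  have bern k : 1 - k%:R * e <= (1 - e) ^+ k.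
    elim: k => [|k IHk]; first by rewrite mul0r subr0 expr0.
    rewrite exprS -natr1; have := ler_wpM2l (_ : 0 <= 1 - e) IHk.
    move=> /(_ ltac:(lra)); have := mulr_ge0 (mulr_ge0 (ler0n R k) e0) e0.
    nra.
  have : X * (x ^+ s * (1 - s%:R * e)) <= X * (2 ^+ p.+1 * sin u) ^+ s.
    rewrite ler_wpM2l//; apply: (@le_trans _ _ ((x * (1 - e)) ^+ s)).
      by rewrite exprMn ler_wpM2l ?exprn_ge0// ltW.
    have xe0 : 0 <= x * (1 - e) by rewrite mulr_ge0 ?subr_ge0// ltW.
    by apply: lerXn2r => //; rewrite nnegrE; exact: le_trans rx.
  have -> : (Q * c * q%:R^-1 + X * x ^+ s * s%:R * x ^+ 2) / 2 ^+ p =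
      Q * (c * (q%:R^-1 / 2 ^+ p)) + X * x ^+ s * s%:R * e by rewrite /e; ring.
  by move=> h1 h2; have := le_trans h1 h2; lra.
(* The limit is taken by contradiction: a positive gap is larger than D / 2^p once 2^p exceeds [M],
   and the term x^2 in [M] ensures e <= 1. *)
rewrite leNgt; apply/negP => gap.
set D := Q * c * q%:R^-1 + X * x ^+ s * s%:R * x ^+ 2 in key.
pose M := Num.max (x ^+ 2) (D / (X * x ^+ s - Q * N1)).
have [p Mp] : exists p, M < 2 ^+ p.
  exists (Num.truncn `|M|).+1.
  apply: (@lt_trans _ _ (Num.truncn `|M|).+1%:R).
    by apply: le_lt_trans (ler_norm _) _; rewrite truncnS_gt.
  by rewrite -natrX ltr_nat ltn_expl.
have p0 : 0 < 2 ^+ p :> R by rewrite exprn_gt0.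
move: Mp; rewrite gt_max => /andP[M1 M2].
have := key p; rewrite ler_pdivrMr// mul1r => /(_ (ltW M1)).
apply/negP; rewrite -ltNge -ltrBrDl ltr_pdivrMr//.
by move: M2; rewrite ltr_pdivrMr ?subr_gt0// mulrC.
Qed.

End KernelDecay.

(** * Sums over the frequencies |l| < n *)

Section FrequencySums.
Context {R : realType}.
Implicit Types (n : nat) (x : R).

Definition freqs_seq n : seq int := [seq m%:Z - n%:Z | m <- index_iota 1 (2 * n)].

Lemma freqs_seq_uniq n : uniq (freqs_seq n).
Proof. by rewrite map_inj_uniq ?iota_uniq// => i j /addIr[]. Qed.

Lemma mem_freqs_seq n l : (l \in freqs_seq n) = (`|l| < n)%N.
Proof.
apply/mapP/idP => [[m]|ln]; first by rewrite mem_index_iota => /andP[m1 m2] ->; lia.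
exists (absz (l + n%:Z)); last by lia.
by rewrite mem_index_iota; lia.
Qed.

Lemma freqsE n : freqs n = [set` freqs_seq n].
Proof. by apply/seteqP; split => l /=; rewrite mem_freqs_seq. Qed.

Lemma norm_freqs n l : l \in freqs_seq n -> `|l%:~R| <= n%:R :> R.
Proof.
rewrite mem_freqs_seq => ln; rewrite -intr_norm -[n%:R]/(n%:~R) ler_int.
by rewrite -abszE lez_nat ltnW.
Qed.

Lemma sum_freqs (V : nmodType) n (F : int -> V) :
  \sum_(l \in freqs n) F l = \sum_(l <- freqs_seq n) F l.
Proof. by rewrite freqsE; exact/esym/fsbig_seq/freqs_seq_uniq. Qed.

(** Adding the frequency -n, of weight zero, gives exactly 2n terms, matching the nodes of
    [grid_sum]. *)
Lemma sum_freqs_ord (V : nmodType) n (F : int -> V) : (0 < n)%N ->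
  F (- n%:Z) = 0 -> \sum_(l \in freqs n) F l = \sum_(m < 2 * n) F (m%:Z - n%:Z).
Proof.
move=> n0 F0; rewrite sum_freqs big_map -(big_mkord xpredT (fun m => F (m%:Z - n%:Z))).
by rewrite [RHS]big_ltn ?muln_gt0// sub0r F0 add0r.
Qed.

End FrequencySums.

(** * The normalized kernel: decay, and size near the origin *)

Section Kernel.
Context {R : realType}.
Variable H : R -> R.
Hypothesis hH : low_pass_filter H.
Variable n : nat.
Hypothesis n0 : (0 < n)%N.
Implicit Types (x : R).

Let w (l : int) : R := H (`|l|%N%:R / n%:R).

Lemma low_pass_weight m : w (m%:Z - n%:Z) = H (m%:R * n%:R^-1 - 1).
Proof.
have [_ _ He _ _] := hH; rewrite /w.
have n1 : n%:R / n%:R = 1 :> R by rewrite divff// pnatr_eq0 lt0n_neq0.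
have [nm|mn] := leqP n m.
  by rewrite subzn// absz_nat natrB// mulrBl n1.
rewrite -opprB abszN subzn ?absz_nat; last exact: ltnW.
by rewrite natrB 1?ltnW// mulrBl n1 He; congr H; lra.
Qed.

Lemma low_pass_weight_n : w (- n%:Z) = 0.
Proof.
have := low_pass_weight 0; rewrite sub0r => ->.
by rewrite mul0r sub0r (low_pass_supp hH)// normrN normr1.
Qed.

Lemma low_pass_weight01 l : 0 <= w l <= 1.
Proof. by case: hH => _ + _ _ _; exact. Qed.

(** The n consecutive indices m starting at the upper half of n satisfy |m/n - 1| <= 1/2, where [H]
    is 1. *)
Lemma sum_weights_ge : n%:R <= \sum_(l \in freqs n) w l.
Proof.
have [_ _ _ H1 _] := hH.
rewrite sum_freqs_ord ?low_pass_weight_n//.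
rewrite -(big_mkord xpredT (fun m : nat => w (m%:Z - n%:Z))).
have un : (uphalf n <= n)%N by rewrite leq_uphalf_double; lia.
rewrite (@big_cat_nat _ _ _ (uphalf n))//=; last by lia.
rewrite (@big_cat_nat _ _ _ (uphalf n + n) (uphalf n))//=; [|lia|lia].
have ge0 a b : 0 <= \sum_(a <= m < b) w (m%:Z - n%:Z).
  by apply: sumr_ge0 => m _; case/andP: (low_pass_weight01 (m%:Z - n%:Z)).
suff h : n%:R <= \sum_(uphalf n <= m < uphalf n + n) w (m%:Z - n%:Z).
  by have := ge0 0%N (uphalf n); have := ge0 (uphalf n + n)%N (2 * n)%N; lra.
apply: (@le_trans _ _ (\sum_(uphalf n <= m < uphalf n + n) 1)).
  by rewrite big_const_nat addKn iter_addr_0.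
apply: ler_sum_nat => m mn; rewrite low_pass_weight H1//.
have n1 : n%:R / n%:R = 1 :> R by rewrite divff// pnatr_eq0 lt0n_neq0.
have ni : 0 < n%:R^-1 :> R by rewrite invr_gt0 ltr0n.
have m1 : n%:R <= 2 * m%:R :> R by rewrite -natrM ler_nat; lia.
have m2 : 2 * m%:R <= 3 * n%:R :> R by rewrite -!natrM ler_nat; lia.
have := ler_wpM2r (ltW ni) m1; have := ler_wpM2r (ltW ni) m2.
by rewrite ler_norml -!mulrA n1; lra.
Qed.

Lemma hbar_gt0 : 0 < hbar H n.
Proof. by rewrite invr_gt0 (lt_le_trans _ sum_weights_ge)// ltr0n. Qed.

Lemma hbar_le : hbar H n <= n%:R^-1.
Proof.
rewrite lef_pV2 ?sum_weights_ge// posrE ?ltr0n//.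
by rewrite (lt_le_trans _ sum_weights_ge)// ltr0n.
Qed.

Lemma hbar_sum : hbar H n * (\sum_(l \in freqs n) w l) = 1.
Proof. by rewrite mulVf// gt_eqF// -invr_gt0; exact: hbar_gt0. Qed.

Definition kernel x : R[i] :=
  (hbar H n)%:C%C * \sum_(l \in freqs n) (w l)%:C%C * expi (l%:~R * x).

Lemma kernel_2piz x (j : int) : kernel (x + j%:~R * (2 * pi)) = kernel x.
Proof.
rewrite /kernel !sum_freqs; congr (_ * _); apply: eq_bigr => l _.
by rewrite mulrDr mulrA -intrM expi_2piz.
Qed.

Lemma kernelN x : kernel (- x) = conjc (kernel x).
Proof.
rewrite /kernel !sum_freqs rmorphM rmorph_sum.
have cr (y : R) : conjc y%:C%C = y%:C%C by rewrite /= oppr0.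
congr (_ * _); first exact/esym/cr.
apply: eq_bigr => l _; rewrite rmorphM mulrN; congr (_ * _); first exact/esym/cr.
by rewrite /expi cosN sinN.
Qed.

Lemma cmod_kernel x : cmod (kernel x) =
  hbar H n * cmod (grid_sum H n%:R^-1 (2 * n) (expi x)).
Proof.
rewrite /kernel Normc.normcM cmod_real (ger0_norm (ltW hbar_gt0)); congr (_ * _).
rewrite sum_freqs_ord ?low_pass_weight_n ?mul0r//.
(* Multiplying by the unimodular e^(inx) turns the frequency m - n into the power m. *)
rewrite -[LHS]mul1r -[X in X * _ = _](cmod_expi (n%:R * x)) -Normc.normcM mulr_sumr; congr cmod.
apply: eq_bigr => m _; rewrite low_pass_weight mulrCA -expiD -expi_natl.
by congr (_ * expi _); rewrite intrD mulrDl mulrNz mulNr addrC subrK.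
Qed.

Lemma cmod_kernel_decay S x : (2 <= S)%N -> `|x| <= pi ->
  cmod (kernel x) * (n%:R * `|x|) ^+ S <=
  14 * Num.sqrt (2 * pi) / 3 * (norm1 (derive1n S H) / norm1 H).
Proof.
case: S => [//|[//|s]] _ xpi.
have /andP[N1 N2] := norm1_low_pass hH.
have NS0 : 0 <= norm1 (derive1n s.+2 H) by exact: Rintegral_ge0.
have sq : 2 <= Num.sqrt (2 * pi) :> R.
  rewrite -[leLHS]ger0_norm// -sqrtr_sqr ler_wsqrtr// expr2 ler_wpM2l//.
  exact: pi_ge2.
have NH0 : 0 <= norm1 (derive1n s.+2 H) / norm1 H by rewrite divr_ge0//; lra.
have [->|x0] := eqVneq x 0.
  rewrite normr0 mulr0 expr0n/= mulr0 mulr_ge0//; lra.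
wlog xp : x x0 xpi / 0 < x => [th|].
  have [|xn] := ltP 0 x; first exact: th.
  have := th (- x); rewrite oppr_eq0 normrN kernelN => /(_ x0 xpi).
  rewrite (_ : cmod (conjc (kernel x)) = cmod (kernel x)); last first.
    by case: (kernel x) => a b; rewrite /= sqrrN.
  by apply; rewrite oppr_gt0 lt_neqAle x0.
rewrite gtr0_norm// cmod_kernel.
have := kernel_decay hH s n0 (_ : 0 < x <= pi).
rewrite xp -[X in X <= _](gtr0_norm xp) xpi => /(_ isT) dec.
have nn : 0 < n%:R :> R by rewrite ltr0n.
have hn : hbar H n <= n%:R^-1 * (2 / norm1 H).
  apply: le_trans hbar_le _; rewrite ler_pMr ?invr_gt0//.
  by rewrite ler_pdivlMr; lra.
rewrite exprMn.
have G0 : 0 <= cmod (grid_sum H n%:R^-1 (2 * n) (expi x)) by exact: cmod_ge0.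
(* 8 is 4 from [kernel_decay] times 2 from [hn]; sqrt(2 pi) >= 2 makes the target factor at least
   28/3. *)
apply: (@le_trans _ _ (8 * (norm1 (derive1n s.+2 H) / norm1 H))); last first.
  by rewrite ler_wpM2r//; lra.
have xs0 : 0 <= n%:R ^+ s.+2 * x ^+ s.+2 by rewrite mulr_ge0 ?exprn_ge0// ltW.
apply: (@le_trans _ _ (n%:R^-1 * (2 / norm1 H) *
    cmod (grid_sum H n%:R^-1 (2 * n) (expi x)) * (n%:R ^+ s.+2 * x ^+ s.+2))).
  by rewrite ler_wpM2r// ler_wpM2r.
rewrite (_ : _ * (n%:R ^+ s.+2 * _) = 2 / norm1 H * n%:R ^+ s.+2 * (n%:R^-1 *
  cmod (grid_sum H n%:R^-1 (2 * n) (expi x)) * x ^+ s.+2)); last by ring.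
apply: (@le_trans _ _ (2 / norm1 H * n%:R ^+ s.+2 *
    (4 * (n%:R^-1 ^+ s.+2 * norm1 (derive1n s.+2 H))))).
  by rewrite ler_wpM2l// mulr_ge0 ?exprn_ge0 ?(ltW nn)// divr_ge0//; lra.
rewrite exprVn le_eqVlt; apply/orP; left; apply/eqP.
have nS : n%:R ^+ s.+2 != 0 :> R by rewrite expf_neq0// gt_eqF.
transitivity ((n%:R ^+ s.+2 / n%:R ^+ s.+2) * (8 * (norm1 (derive1n s.+2 H) / norm1 H))).
  by ring.
by rewrite divff// mul1r.
Qed.

(** The real part is an average, with weights of total mass 1, of cosines of angles at most n / (4n)
    = 1/4, and cos(1/4) >= 1 - 1/32. *)
Lemma cmod_kernel_near x : `|x| <= (4 * n%:R)^-1 -> 31 / 32 <= cmod (kernel x).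
Proof.
move=> xn; apply: (@le_trans _ _ (complex.Re (kernel x))); last first.
  exact: cmod_ge_Re.
rewrite /kernel Re_mul_real sum_freqs Re_sum.
rewrite -[leLHS]mul1r -[X in X * _ <= _]hbar_sum -mulrA ler_wpM2l ?(ltW hbar_gt0)//.
rewrite sum_freqs mulr_suml big_seq [leRHS]big_seq; apply: ler_sum => l ln.
rewrite Re_mul_real ler_wpM2l//; first by case/andP: (low_pass_weight01 l).
apply: le_trans (cos_ge_quadratic _).
have nn : 0 < n%:R :> R by rewrite ltr0n.
have lx : `|l%:~R * x| <= 1 / 4.
  rewrite normrM; apply: (@le_trans _ _ (n%:R * (4 * n%:R)^-1)).
    by apply: ler_pM => //; exact: norm_freqs.
  by rewrite invfM mulrCA divff ?gt_eqF// mulr1 mul1r.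
have : `|l%:~R * x| ^+ 2 <= (1 / 4) ^+ 2 by rewrite lerXn2r// nnegrE.
by rewrite real_normK ?num_real//; lra.
Qed.

End Kernel.

(** * From indicators to nonnegative functions under the integral *)

Section ProductExpectation.
Context d (T : measurableType d) (R : realType) (mu : {measure set T -> \bar R}).
Local Open Scope ereal_scope.
Import HBNNSimple.

Lemma measurable_indic_comp (A : set R) (X : T -> R) : measurable A ->
  measurable_fun setT X -> measurable_fun setT (fun w => \1_A (X w) : R).
Proof.
move=> mA mX; rewrite (_ : (fun _ => _) = \1_(X @^-1` A))//.
by apply: measurable_indic; rewrite -[_ @^-1` _]setTI; exact: mX.
Qed.

(** Both sides are additive in f and compatible with increasing limits, so equality on indicators
    extends to simple functions and then to f. With [Y2] constant, it factors [f (X w)] out of an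
    expectation. *)
Lemma eq_integral_comp (X Y1 Y2 : T -> R) (f : R -> R) :
  measurable_fun setT X -> measurable_fun setT Y1 -> measurable_fun setT Y2 ->
  measurable_fun setT f ->
  (forall w, 0 <= Y1 w)%R -> (forall w, 0 <= Y2 w)%R -> (forall x, 0 <= f x)%R ->
  (forall B : set R, measurable B ->
    \int[mu]_w (\1_B (X w) * Y1 w)%:E = \int[mu]_w (\1_B (X w) * Y2 w)%:E) ->
  \int[mu]_w (f (X w) * Y1 w)%:E = \int[mu]_w (f (X w) * Y2 w)%:E.
Proof.
move=> mX mY1 mY2 mf Y10 Y20 f0 eqB.
have mEf : measurable_fun setT (fun x : R => (f x)%:E) by exact/measurable_EFinP.
pose f_ := nnsfun_approx measurableT mEf.
have lim_f (Y : T -> R) : measurable_fun setT Y -> (forall w, 0 <= Y w)%R ->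
    \int[mu]_w (f (X w) * Y w)%:E = limn (fun n => \int[mu]_w (f_ n (X w) * Y w)%:E).
  move=> mY Y0; rewrite -monotone_convergence//.
  - apply: eq_integral => w _; apply/esym/cvg_lim => //.
    under eq_fun do rewrite EFinM.
    rewrite EFinM; apply: cvgeZr => //.
    by apply: (@cvg_nnsfun_approx _ _ _ _ measurableT _ mEf) => // x _; rewrite lee_fin.
  - move=> n; apply/measurable_EFinP/measurable_funM => //.
    exact: measurableT_comp.
  - by move=> n w _; rewrite lee_fin mulr_ge0.
  - move=> w _ m n mn; rewrite lee_fin ler_wpM2r//.
    exact/lefP/nd_nnsfun_approx.
rewrite (lim_f Y1)// (lim_f Y2)//; congr (limn _); apply/funext => n.
have sum_f (Y : T -> R) : measurable_fun setT Y -> (forall w, 0 <= Y w)%R ->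
    \int[mu]_w (f_ n (X w) * Y w)%:E = \sum_(k \in range (f_ n))
      k%:E * \int[mu]_w (\1_(f_ n @^-1` [set k]) (X w) * Y w)%:E.
  move=> mY Y0.
  have mind k : measurable_fun setT (fun w => \1_(f_ n @^-1` [set k]) (X w) : R).
    by apply: measurable_indic_comp.
  transitivity (\int[mu]_w \sum_(k \in range (f_ n))
      (k * \1_(f_ n @^-1` [set k]) (X w) * Y w)%:E).
    apply: eq_integral => w _; rewrite fsumEFin// {1}fimfunE; congr EFin.
    by rewrite mulr_fsuml.
  rewrite ge0_integral_fsum//.
  - apply: eq_fsbigr => r /set_mem[x _ rx].
    rewrite -ge0_integralZl_EFin//.
    + by apply: eq_integral => w _; rewrite -!EFinM mulrA.
    + by move=> w _; rewrite lee_fin mulr_ge0.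
    + by apply/measurable_EFinP/measurable_funM.
    + by rewrite -rx.
  - move=> k.
    by apply/measurable_EFinP; do 2 apply: measurable_funM => //.
  - move=> k w _; rewrite EFinM mule_ge0// ?lee_fin//; exact: nnfun_muleindic_ge0.
by rewrite sum_f// sum_f//; apply: eq_fsbigr => k _; rewrite eqB.
Qed.

End ProductExpectation.

(** * Expectation of a product of independent variables *)

Section Independence.
Context d (T : measurableType d) (R : realType) (P : probability T R).
Context (I : choiceType).
Implicit Types (s t : seq I) (X : I -> T -> R).

(** Only the full list [s] appears: for distinct indices, taking some of the sets equal to the whole
    line gives the product formula for the sublists. *)
Definition rindependent s X := forall B : I -> set R, (forall l, measurable (B l)) ->
  P (\bigcap_(l in [set` s]) (X l @^-1` B l)) = (\prod_(l <- s) P (X l @^-1` B l))%E.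

Lemma indic_prod s X (B : I -> set R) w :
  \1_(\bigcap_(l in [set` s]) (X l @^-1` B l)) w = \prod_(l <- s) \1_(B l) (X l w) :> R.
Proof.
elim: s => [|l s IH].
  by rewrite big_nil indicE mem_set// => l; rewrite /= in_nil.
rewrite big_cons -IH !indicE -natrM mulnb; congr (_%:R); congr nat_of_bool.
apply/idP/andP => [/set_mem h|[/set_mem h1 /set_mem h2]]; last first.
  by apply/mem_set => k /=; rewrite inE => /predU1P[->//|ks]; exact: h2.
split; apply/mem_set; first by apply: (h l); rewrite /= mem_head.
by move=> k /= ks; apply: (h k); rewrite /= inE ks orbT.
Qed.

(* Indicators are turned into arbitrary functions one index at a time. *)
Lemma integral_prod_indep s X (f : I -> R -> R) (e : I -> R) : uniq s ->
  (forall l, l \in s -> measurable_fun setT (X l)) ->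
  (forall l, measurable_fun setT (f l)) -> (forall l x, 0 <= f l x) ->
  (forall l, l \in s -> (\int[P]_w (f l (X l w))%:E = (e l)%:E)%E) ->
  rindependent s X ->
  (\int[P]_w (\prod_(l <- s) f l (X l w))%:E = (\prod_(l <- s) e l)%:E)%E.
Proof.
move=> us mX mf f0 ef ind.
suff gen s1 s2 (B : I -> set R) : s1 ++ s2 = s -> (forall l, measurable (B l)) ->
    (\int[P]_w (\prod_(l <- s1) f l (X l w) * \prod_(l <- s2) \1_(B l) (X l w))%:E =
     (\prod_(l <- s1) e l * \prod_(l <- s2) fine (P (X l @^-1` B l)))%:E)%E.
  have := gen s [::] (fun=> setT) (cats0 s) (fun=> measurableT).
  by rewrite !big_nil mulr1 => <-; apply: eq_integral => w _; rewrite big_nil mulr1.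
have mpre l (A : set R) : l \in s -> measurable A -> measurable (X l @^-1` A).
  by move=> ls mA; rewrite -[_ @^-1` _]setTI; exact: mX.
elim/last_ind: s1 s2 B => [|s1 l IH] s2 B s12 mB.
  rewrite big_nil mul1r; under eq_integral do rewrite big_nil mul1r -indic_prod.
  rewrite -s12 /= in ind mpre *; rewrite integral_indic//=; last first.
    by apply: fin_bigcap_measurable => [|k ks]; [exact: finite_seq|exact: mpre].
  rewrite setIT ind// -prodEFin big_seq [in RHS]big_seq; apply: eq_bigr => k ks.
  by rewrite fineK// fin_num_measure//; exact: mpre.
have s12' : s1 ++ l :: s2 = s by rewrite -cat_rcons.
have ls : l \in s by rewrite -s12' mem_cat mem_head orbT.
have ls2 : l \notin s2.
  by move: us; rewrite -s12' cat_uniq /= => /and3P[_ _ /andP[]].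
pose Y w := \prod_(k <- s1) f k (X k w) * \prod_(k <- s2) \1_(B k) (X k w).
pose c := \prod_(k <- s1) e k * \prod_(k <- s2) fine (P (X k @^-1` B k)).
have sub1 k : k \in s1 -> k \in s by rewrite -s12' mem_cat => ->.
have sub2 k : k \in s2 -> k \in s by rewrite -s12' mem_cat inE => ->; rewrite !orbT.
have Y0 w : 0 <= Y w by rewrite mulr_ge0// prodr_ge0.
have e0 k : k \in s -> 0 <= e k.
  by move=> ks; rewrite -lee_fin -ef// integral_ge0// => w _; rewrite lee_fin.
have c0 : 0 <= c.
  rewrite mulr_ge0//; last by rewrite prodr_ge0// => k _; rewrite fine_ge0.
  by rewrite big_seq prodr_ge0// => k /sub1; exact: e0.
have mprod (r : seq I) (g : I -> T -> R) : (forall k, k \in r -> measurable_fun setT (g k)) ->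
    measurable_fun setT (fun w => \prod_(k <- r) g k w).
  elim: r => [|k r IHr] mg.
    by under eq_fun do rewrite big_nil; exact: measurable_cst.
  under eq_fun do rewrite big_cons; apply: measurable_funM.
    by apply: mg; rewrite mem_head.
  by apply: IHr => k' kr; apply: mg; rewrite inE kr orbT.
have mY : measurable_fun setT Y.
  apply: measurable_funM; apply: mprod => k ks.
    by apply: measurableT_comp => //; apply: mX; exact: sub1.
  by apply: measurable_indic_comp => //; apply: mX; exact: sub2.
have -> : (\int[P]_w (\prod_(k <- rcons s1 l) f k (X k w) *
    \prod_(k <- s2) \1_(B k) (X k w))%:E = \int[P]_w (f l (X l w) * Y w)%:E)%E.
  apply: eq_integral => w _; rewrite big_rcons/= /Y.
  by congr EFin; ring.
(* Replacing [Y] by the constant [c] needs checking only on indicators of [X l], and there the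
   induction hypothesis applies with l moved to the indicator side. *)
rewrite (@eq_integral_comp _ _ _ _ _ Y (fun=> c))//; [|exact: mX|].
- under eq_integral do rewrite EFinM.
  rewrite ge0_integralZr//; last 2 first.
  + by apply/measurable_EFinP/measurableT_comp => //; exact: mX.
  + by move=> w _; rewrite lee_fin.
  by rewrite ef// -EFinM big_rcons/= /c; congr EFin; ring.
move=> A mA.
under [RHS]eq_integral do rewrite EFinM.
rewrite ge0_integralZr//; last first.
  by apply/measurable_EFinP; apply: measurable_indic_comp => //; exact: mX.
have -> : (\int[P]_w (\1_A (X l w))%:E = P (X l @^-1` A))%E.
  under eq_integral => w _ do rewrite (_ : \1_A (X l w) = \1_(X l @^-1` A) w :> R)//.
  by rewrite integral_indic//= ?setIT//; exact: mpre.
pose B' k := if k == l then A else B k.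
have := IH (l :: s2) B' s12' _.
have -> : (\int[P]_w (\prod_(k <- s1) f k (X k w) *
    \prod_(k <- l :: s2) \1_(B' k) (X k w))%:E = \int[P]_w (\1_A (X l w) * Y w)%:E)%E.
  apply: eq_integral => w _; rewrite big_cons /Y {1}/B' eqxx.
  rewrite (_ : \prod_(k <- s2) \1_(B' k) (X k w) = \prod_(k <- s2) \1_(B k) (X k w)).
    by congr EFin; ring.
  rewrite big_seq [RHS]big_seq; apply: eq_bigr => k ks; rewrite /B'.
  by case: eqVneq ks => // ->; rewrite (negbTE ls2).
move=> ->; last by move=> k; rewrite /B'; case: ifP.
rewrite big_cons {1}/B' eqxx (_ : \prod_(k <- s2) fine (P (X k @^-1` B' k)) =
   \prod_(k <- s2) fine (P (X k @^-1` B k))); last first.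
  rewrite big_seq [RHS]big_seq; apply: eq_bigr => k ks; rewrite /B'.
  by case: eqVneq ks => // ->; rewrite (negbTE ls2).
rewrite mulrCA EFinM fineK// fin_num_measure//; exact: mpre.
Qed.

End Independence.

(** * Tail bounds for weighted sums, and the union bound *)

Section SubgaussianSums.
Context d (T : measurableType d) (R : realType) (P : probability T R).
Context (I : choiceType).
Implicit Types (s : seq I) (X : I -> T -> R) (V : R).

Lemma subgaussian_mgf V (X : T -> R) t : subgaussian P V X ->
  exists2 e : R, e <= expR ((t * V) ^+ 2 / 2) &
    (\int[P]_w (expR (X w * t))%:E = e%:E)%E.
Proof.
case=> mX _ /(_ t); have E0 : (0 <= 'M_P X t)%E.
  by apply: expectation_ge0 => w; exact: expR_ge0.
move=> Mt; have ME : ('M_P X t = \int[P]_w (expR (X w * t))%:E)%E.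
  by rewrite /mmt_gen_fun unlock.
have : ('M_P X t <= (expR ((t * V) ^+ 2 / 2))%:E)%E.
  by move: E0; rewrite -lneK_eq => /eqP <-; rewrite -[leRHS]/(expeR _%:E) lee_expeR.
rewrite -ME; case: ('M_P X t) E0 => [e _ |//|//].
by rewrite lee_fin => eV; exists e.
Qed.

Lemma measurable_linear s (a : I -> R) X :
  (forall l, l \in s -> measurable_fun setT (X l)) ->
  measurable_fun setT (fun w => \sum_(l <- s) a l * X l w).
Proof.
elim: s => [|l s IH] mX.
  by under eq_fun do rewrite big_nil; exact: measurable_cst.
under eq_fun do rewrite big_cons; apply: measurable_funD.
  by apply: measurable_funM => //; apply: mX; rewrite mem_head.
by apply: IH => k ks; apply: mX; rewrite inE ks orbT.
Qed.

Lemma subgaussian_sum_tail s (a : I -> R) X V (v r : R) : uniq s ->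
  (forall l, l \in s -> subgaussian P V (X l)) -> rindependent P s X ->
  0 < V -> 0 < v -> 0 < r -> \sum_(l <- s) a l ^+ 2 <= v ->
  (P [set w | (r <= \sum_(l <- s) a l * X l w)%R] <=
   (expR (- (r ^+ 2 / (2 * V ^+ 2 * v))))%:E)%E.
Proof.
move=> us sX ind V0 v0 r0 av.
have mX l : l \in s -> measurable_fun setT (X l) by move=> /sX[].
have mZ := measurable_linear a mX.
set Z := fun w => \sum_(l <- s) a l * X l w in mZ *.
set A := [set w | _].
have mA : measurable A.
  rewrite (_ : A = setT `&` Z @^-1` `[r, +oo[); first exact: mZ.
  by rewrite setTI; apply/seteqP; split => w /=; rewrite in_itv/= andbT.
(* The minimizer of t^2 V^2 v / 2 - t r, the exponent in Chernoff's bound. *)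
pose t := r / (V ^+ 2 * v).
have t0 : 0 < t by rewrite divr_gt0// mulr_gt0// exprn_gt0.
have /choice[e eP] : forall l, exists e : R, l \in s ->
    e <= expR ((t * a l * V) ^+ 2 / 2) /\
    (\int[P]_w (expR (X l w * (t * a l)))%:E = e%:E)%E.
  move=> l; case: (boolP (l \in s)) => [ls|_]; last by exists 0.
  by have [e e1 e2] := subgaussian_mgf (t * a l) (sX l ls); exists e.
have Eprod := integral_prod_indep (f := fun l x => expR (x * (t * a l))) us mX
  (fun l => _) (fun l x => expR_ge0 _) (fun l ls => (eP l ls).2) ind.
have {}Eprod := Eprod _.
have EZ : (\int[P]_w (expR (t * Z w))%:E = (\prod_(l <- s) e l)%:E)%E.
  rewrite -Eprod; last first.
    by move=> l; apply: measurableT_comp => //; exact: measurable_funM.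
  apply: eq_integral => w _; rewrite -expR_sum; congr (expR _)%:E.
  by rewrite /Z mulr_sumr; apply: eq_bigr => l _; rewrite [RHS]mulrC mulrA.
have prod_le : \prod_(l <- s) e l <= expR (t ^+ 2 * V ^+ 2 * v / 2).
  apply: (@le_trans _ _ (\prod_(l <- s) expR ((t * a l * V) ^+ 2 / 2))).
    rewrite big_seq [leRHS]big_seq; apply: ler_prod => l ls.
    have [e1 e2] := eP l ls; rewrite e1 andbT -lee_fin -e2 integral_ge0// => w _.
  rewrite -expR_sum ler_expR.
  rewrite (_ : \sum_(l <- s) _ = t ^+ 2 * V ^+ 2 / 2 * \sum_(l <- s) a l ^+ 2); last first.
    by rewrite mulr_sumr; apply: eq_bigr => l _; rewrite !exprMn; lra.
  by rewrite [leRHS]mulrAC ler_wpM2l// divr_ge0// mulr_ge0// sqr_ge0.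
rewrite -[A]setIT -integral_indic//.
have mE : measurable_fun setT (fun w => expR (t * Z w)).
  by apply: measurableT_comp => //; exact: measurable_funM.
(* Markov's inequality: the indicator of Z >= r is at most exp(t (Z - r)). *)
apply: (@le_trans _ _ (\int[P]_w ((expR (t * Z w))%:E * (expR (- (t * r)))%:E))%E).
  apply: ge0_le_integral => //.
  - by apply/measurable_EFinP; exact: measurable_indic.
  - by apply: emeasurable_funM => //; exact/measurable_EFinP.
  - move=> w _; rewrite -EFinM lee_fin -expRD indicE.
    case: (boolP (w \in A)) => [/set_mem wA|_]; last exact: expR_ge0.
    by rewrite -expR0 ler_expR -mulrBr mulr_ge0// ?subr_ge0// ltW.
rewrite ge0_integralZr//; last exact/measurable_EFinP.
rewrite EZ -EFinM lee_fin.
apply: le_trans (ler_wpM2r (expR_ge0 _) prod_le) _.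
rewrite -expRD ler_expR le_eqVlt; apply/orP; left; apply/eqP; rewrite /t.
by field; rewrite !gt_eqF.
Qed.

Lemma subgaussian_sum_abs_tail s (a : I -> R) X V (v r : R) : uniq s ->
  (forall l, l \in s -> subgaussian P V (X l)) -> rindependent P s X ->
  0 < V -> 0 < v -> 0 < r -> \sum_(l <- s) a l ^+ 2 <= v ->
  exists B : set T, [/\ measurable B,
    (P B <= (2 * expR (- (r ^+ 2 / (2 * V ^+ 2 * v))))%:E)%E
    & forall w, ~ B w -> `|\sum_(l <- s) a l * X l w| <= r].
Proof.
move=> us sX ind V0 v0 r0 av.
have mX l : l \in s -> measurable_fun setT (X l) by move=> /sX[].
have meas (b : I -> R) : measurable [set w | r <= \sum_(l <- s) b l * X l w].
  rewrite (_ : [set w | _] =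
      setT `&` (fun w => \sum_(l <- s) b l * X l w) @^-1` `[r, +oo[).
    exact: measurable_linear.
  by rewrite setTI; apply/seteqP; split => w /=; rewrite in_itv/= andbT.
exists ([set w | r <= \sum_(l <- s) a l * X l w] `|`
        [set w | r <= \sum_(l <- s) (- a l) * X l w]); split.
- exact: measurableU.
- apply: le_trans (measureU2 _ _ _) _ => //.
  rewrite mulrDl mul1r EFinD; apply: leeD; apply: subgaussian_sum_tail => //.
  by under eq_bigr do rewrite sqrrN.
- move=> w /not_orP[/negP + /negP]; rewrite -!ltNge => h1.
  under eq_bigr do rewrite mulNr; rewrite sumrN => h2.
  by rewrite ler_norml; lra.
Qed.

(** Measurability is carried by the exceptional sets, so that [Q j] may quantify over uncountably
    many x. *)
Lemma union_bound (J : eqType) (s : seq J) (Q : J -> T -> Prop) (q : R) :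
  (forall j, j \in s -> exists B : set T, [/\ measurable B, (P B <= q%:E)%E
    & forall w, ~ B w -> Q j w]) ->
  exists B : set T, [/\ measurable B, (P B <= ((size s)%:R * q)%:E)%E
    & forall w, ~ B w -> forall j, j \in s -> Q j w].
Proof.
elim: s => [|j s IH] hQ.
  by exists set0; split; rewrite ?measure0 ?mul0r.
have [|B [mB PB BQ]] := IH; first by move=> k ks; apply: hQ; rewrite inE ks orbT.
have [|C [mC PC CQ]] := hQ j; first exact: mem_head.
exists (B `|` C); split; first exact: measurableU.
  apply: le_trans (measureU2 _ _ _) _ => //.
  by rewrite /= -natr1 mulrDl mul1r EFinD leeD.
move=> w /not_orP[wB wC] k; rewrite inE => /predU1P[->|]; first exact: CQ.
exact: BQ.
Qed.

End SubgaussianSums.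

(** * A uniform bound for one real component of the noise *)

Section NoiseBound.
Context d (Omega : measurableType d) (R : realType) (P : probability Omega R).
Implicit Types (V : R) (n : nat).

Lemma subgaussian_le V V' (X : Omega -> R) : 0 <= V <= V' ->
  subgaussian P V X -> subgaussian P V' X.
Proof.
move=> /andP[V0 VV'] [mX EX MX]; split=> // t; apply: le_trans (MX t) _.
rewrite lee_fin ler_wpM2r// !exprMn ler_wpM2l ?sqr_ge0//.
by rewrite lerXn2r// nnegrE// (le_trans V0).
Qed.

(** Used with [g] a projection: real and imaginary parts form two families, each independent. The
    two are never combined in one Chernoff bound, since the joint law within a term is arbitrary. *)
Lemma cindependent_comp n (eps : int -> Omega -> R[i]) (g : R * R -> R) :
  measurable_fun setT g -> cindependent P (freqs n) eps ->
  rindependent P (freqs_seq n)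
    (fun l w => g (complex.Re (eps l w), complex.Im (eps l w))).
Proof.
move=> mg ind B mB.
pose F : {fset int} := [fset l in freqs_seq n]%fset.
have memF : [set` F] = [set` freqs_seq n].
  by apply/seteqP; split => l /=; rewrite !inE.
have := ind F (fun l => g @^-1` B l) _ _.
rewrite memF -freqsE; move=> ->//; last first.
  by move=> j; rewrite -[_ @^-1` _]setTI; exact: mg.
apply: perm_big; apply: uniq_perm => //; first exact: freqs_seq_uniq.
by move=> l; rewrite !inE.
Qed.

Lemma noise_part_bound n (c : int -> R) (phi : R -> R) (X : int -> Omega -> R)
    V (delta : R) : (0 < n)%N -> 0 < V -> 0 < delta < 1 ->
  (forall l, 0 <= c l) -> \sum_(l <- freqs_seq n) c l = 1 ->
  \sum_(l <- freqs_seq n) c l ^+ 2 <= n%:R^-1 ->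
  (forall x y, `|phi x - phi y| <= `|x - y|) -> (forall x, `|phi x| <= 1) ->
  (forall l, l \in freqs_seq n -> subgaussian P V (X l)) ->
  rindependent P (freqs_seq n) X ->
  exists B : set Omega, [/\ measurable B,
    (P B <= (10 * n%:R ^+ 2 * (2 * (10 * n%:R / delta) ^- 2))%:E)%E
    & forall w, ~ B w -> forall x, 0 <= x < 2 * pi ->
      `|\sum_(l <- freqs_seq n) c l * phi (l%:~R * x) * X l w| <=
      4 * V * Num.sqrt (ln (10 * n%:R / delta) / n%:R)].
Proof.
(* The number of tail events: 8n^2 grid points of spacing n^-2, enough since 2 pi < 8, and the 2n -
   1 single noise terms. *)
move=> n0; have card_tests : (8 * n ^ 2 + (2 * n - 1) <= 10 * n ^ 2)%N.
  by have := leq_pmulr n n0; rewrite expnS expn1; lia.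
move=> V0 /andP[d0 d1] c0 c1 c2 philip phi1 sX ind.
set s := freqs_seq n in c1 c2 sX ind *.
have us : uniq s by exact: freqs_seq_uniq.
have nn : 0 < n%:R :> R by rewrite ltr0n.
have n1 : 1 <= n%:R :> R by rewrite ler1n.
set y := 10 * n%:R / delta.
have y1 : 1 < y by rewrite ltr_pdivlMr//; lra.
have L0 : 0 < ln y by rewrite ln_gt0.
set L := ln y in L0 *.
(* With this threshold the Chernoff exponent is 2 ln y, so each test fails with probability at most
   2 y^-2. *)
have tail (a : int -> R) v : 0 < v -> \sum_(l <- s) a l ^+ 2 <= v ->
  exists B : set Omega, [/\ measurable B, (P B <= (2 * y ^- 2)%:E)%E
    & forall w, ~ B w -> `|\sum_(l <- s) a l * X l w| <= 2 * V * Num.sqrt (L * v)].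
  move=> v0 av.
  have r0 : 0 < 2 * V * Num.sqrt (L * v) by rewrite !mulr_gt0// sqrtr_gt0 mulr_gt0.
  have := subgaussian_sum_abs_tail us sX ind V0 v0 r0 av.
  rewrite (_ : expR _ = y ^- 2)//.
  rewrite !exprMn sqr_sqrtr ?mulr_ge0 ?(ltW L0) ?(ltW v0)//.
  rewrite (_ : - _ = - L + - L); last by field; rewrite !gt_eqF.
  rewrite expRD expRN lnK ?posrE; last by lra.
  by rewrite -expr2 exprVn /y !exprMn.
have [B1 [mB1 PB1 B1P]] : exists B : set Omega, [/\ measurable B,
    (P B <= ((size (iota 0 (8 * n ^ 2)))%:R * (2 * y ^- 2))%:E)%E
    & forall w, ~ B w -> forall j, j \in iota 0 (8 * n ^ 2) ->
      `|\sum_(l <- s) c l * phi (l%:~R * (j%:R / n%:R ^+ 2)) * X l w| <=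
      2 * V * Num.sqrt (L / n%:R)].
  apply: union_bound => j _.
  apply: tail; first by rewrite invr_gt0.
  apply: le_trans c2; apply: ler_sum => l _; rewrite exprMn.
  rewrite ler_piMr ?sqr_ge0// -[leLHS]real_normK ?num_real//.
  by rewrite exprn_ile1.
have [B2 [mB2 PB2 B2P]] : exists B : set Omega, [/\ measurable B,
    (P B <= ((size s)%:R * (2 * y ^- 2))%:E)%E
    & forall w, ~ B w -> forall l, l \in s -> `|X l w| <= 2 * V * Num.sqrt L].
  apply: union_bound => l ls.
  (* A weight concentrated at l turns the tail bound for sums into one for [X l] alone. *)
  have [|B [mB PB BP]] := tail (fun k => (k == l)%:R) 1 ltr01.
    rewrite (bigD1_seq l)//= eqxx expr1n big1 ?addr0// => k /negbTE ->.
    by rewrite expr0n.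
  exists B; split=> // w /BP; rewrite mulr1 (bigD1_seq l)//= eqxx mul1r big1 ?addr0//.
  by move=> k /negbTE ->; rewrite mul0r.
exists (B1 `|` B2); split; first exact: measurableU.
  apply: le_trans (measureU2 _ _ _) _ => //.
  apply: le_trans (leeD PB1 PB2) _; rewrite -EFinD lee_fin -mulrDl.
  rewrite ler_wpM2r ?mulr_ge0 ?invr_ge0 ?exprn_ge0//; first by lra.
  rewrite size_iota size_map size_iota -natrD -natrX -natrM ler_nat.
  exact: card_tests.
move=> w /not_orP[/B1P b1 /B2P b2] x /andP[x0 xpi].
pose j := Num.truncn (x * n%:R ^+ 2).
have nn2 : 0 < n%:R ^+ 2 :> R by rewrite exprn_gt0.
have /andP[j1 j2] : j%:R <= x * n%:R ^+ 2 < j.+1%:R.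
  by apply: truncn_itv; rewrite mulr_ge0// ltW.
have js : j \in iota 0 (8 * n ^ 2).
  rewrite mem_iota /= add0n -(ltr_nat R) (le_lt_trans j1)// natrM natrX.
  rewrite ltr_pM2r//; have := @pihalf_lt2 R; lra.
have xj : `|x - j%:R / n%:R ^+ 2| <= n%:R ^- 2.
  rewrite ger0_norm; last by rewrite subr_ge0 ler_pdivrMr.
  rewrite [leRHS](_ : _ = j.+1%:R / n%:R ^+ 2 - j%:R / n%:R ^+ 2).
    by rewrite lerD2r ler_pdivlMr// ltW.
  by rewrite -mulrBl -natr1 addrAC subrr add0r mul1r.
set S := \sum_(l <- s) _; set S' := \sum_(l <- s) c l * phi (l%:~R * (j%:R / n%:R ^+ 2)) * X l w.
have S1 : `|S'| <= 2 * V * Num.sqrt (L / n%:R) by exact: b1.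
suff : `|S - S'| <= 2 * V * Num.sqrt (L / n%:R).
  by have := ler_normD (S - S') S'; rewrite subrK; lra.
(* Passing from x to the grid point moves each phase by at most n / n^2 = 1/n; as the weights sum to
   1, the oscillation is at most 2 V sqrt(L) / n. *)
have rho : 2 * V * Num.sqrt L / n%:R <= 2 * V * Num.sqrt (L / n%:R).
  rewrite -mulrA ler_wpM2l ?mulr_ge0 ?(ltW V0)//.
  rewrite -[n%:R^-1 in leLHS]ger0_norm ?invr_ge0 ?(ltW nn)// -sqrtr_sqr.
  rewrite -sqrtrM ?(ltW L0)// ler_wsqrtr// ler_wpM2l ?(ltW L0)// expr2.
  by rewrite ler_piMl ?invr_ge0 ?(ltW nn)// invf_le1.
apply: le_trans rho; rewrite /S /S' -sumrB.
apply: le_trans (ler_norm_sum _ _ _) _.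
apply: (@le_trans _ _ (\sum_(l <- s) c l * (2 * V * Num.sqrt L / n%:R))).
  rewrite big_seq [leRHS]big_seq; apply: ler_sum => l ls.
  rewrite -mulrBl -mulrBr !normrM (ger0_norm (c0 l)) -mulrA ler_wpM2l//.
  rewrite mulrC ler_pM ?b2//.
  apply: le_trans (philip _ _) _; rewrite -mulrBr normrM.
  apply: (@le_trans _ _ (n%:R * n%:R ^- 2)).
    by apply: ler_pM => //; exact: norm_freqs.
  by rewrite expr2 invfM mulrA divff ?gt_eqF// mul1r.
by rewrite -mulr_suml c1 mul1r.
Qed.

End NoiseBound.

(** * The distance on the circle *)

Section CircleDistanceFacts.
Context {R : realType}.
Implicit Types (x y z : circle R) (r : R).

Lemma reduce_2pi r a : exists j : int, a <= r + j%:~R * (2 * pi) < a + 2 * pi.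
Proof.
have : 0 < 2 * pi :> R by rewrite mulr_gt0// pi_gt0.
move: (2 * pi) => p p0.
exists (- Num.floor ((r - a) / p)).
have /andP[] := floor_itv ((r - a) / p).
rewrite ler_pdivlMr// ltr_pdivrMr//; move: (Num.floor _) => k.
rewrite intrD mulrDl mul1r mulrNz mulNr; lra.
Qed.

Lemma repr_pi r : exists j : int, repr (\pi_(circle R)%qT r) = r + j%:~R * (2 * pi).
Proof.
have p0 : 2 * pi != 0 :> R by rewrite mulf_neq0// gt_eqF// pi_gt0.
have : eq_mod2pi (repr (\pi_(circle R)%qT r)) r.
  by apply/eqmodP; rewrite reprK.
move=> /intrP[j jE]; exists j; rewrite -jE divfK//; lra.
Qed.

Lemma cdist_le x y (j : int) : cdist x y <= `|repr x - repr y + j%:~R * (2 * pi)|.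
Proof. by apply: ge_inf; [exists 0 => _ [i _ <-]|exists j]. Qed.

(** The translate lying in [-pi, pi] attains the infimum: any other one differs from it by at least
    2 pi, so has modulus at least pi. *)
Lemma cdist_attained x y : exists j : int,
  cdist x y = `|repr x - repr y + j%:~R * (2 * pi)| /\ cdist x y <= pi.
Proof.
have [j /andP[j1 j2]] := reduce_2pi (repr x - repr y) (- pi).
have jpi : `|repr x - repr y + j%:~R * (2 * pi)| <= pi by rewrite ler_norml; lra.
exists j; split; last exact: le_trans (cdist_le x y j) jpi.
apply/eqP; rewrite eq_le cdist_le/=; apply: lb_le_inf.
  by exists `|repr x - repr y|; exists 0 => //; rewrite mul0r addr0.
move=> _ [i _ <-]; have := @pi_gt0 R => p0.
have [->//|ij] := eqVneq i j.
apply: (le_trans jpi).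
have -> : repr x - repr y + i%:~R * (2 * pi) =
    (i - j)%:~R * (2 * pi) + (repr x - repr y + j%:~R * (2 * pi)).
  by rewrite intrB; ring.
have ij1 : 1 <= `|(i - j)%:~R| :> R.
  by rewrite -intr_norm -[1]/(1%:~R) ler_int -gtz0_ge1 normr_gt0 subr_eq0.
have ij2 : 2 * pi <= `|(i - j)%:~R * (2 * pi)| :> R.
  rewrite normrM (ger0_norm (x := 2 * pi)); last by lra.
  by rewrite ler_peMl//; lra.
have := lerB_normD ((i - j)%:~R * (2 * pi)) (repr x - repr y + j%:~R * (2 * pi)).
lra.
Qed.

Lemma cdist_ge0 x y : 0 <= cdist x y.
Proof. by have [j [-> _]] := cdist_attained x y. Qed.

Lemma cdistxx x : cdist x x = 0.
Proof.
apply/eqP; rewrite eq_le cdist_ge0 andbT.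
by have := cdist_le x x 0; rewrite subrr mul0r addr0 normr0.
Qed.

Lemma cdistC x y : cdist x y = cdist y x.
Proof.
suff h (u v : circle R) : cdist u v <= cdist v u by apply/eqP; rewrite eq_le !h.
have [j [-> _]] := cdist_attained v u; apply: le_trans (cdist_le u v (- j)) _.
by rewrite mulrNz mulNr -normrN opprD opprK opprB.
Qed.

Lemma cdist_triangle y x z : cdist x z <= cdist x y + cdist y z.
Proof.
have [i [-> _]] := cdist_attained x y; have [j [-> _]] := cdist_attained y z.
apply: le_trans (cdist_le x z (i + j)) _; apply: le_trans (ler_normD _ _).
by rewrite le_eqVlt; apply/orP; left; apply/eqP; congr `|_|; rewrite intrD; ring.
Qed.

Lemma cdist_pi_le x r : cdist (\pi_(circle R)%qT r) x <= `|r - repr x|.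
Proof.
have [j jE] := repr_pi r; apply: le_trans (cdist_le _ _ (- j)) _.
by rewrite jE mulrNz mulNr addrAC addrK.
Qed.

(** An arc about y becomes a segment of reals about [repr y], on which compactness is available. *)
Lemma cdist_lift x y : exists2 r, \pi_(circle R)%qT r = x & cdist x y = `|r - repr y|.
Proof.
have [j [jE _]] := cdist_attained x y.
exists (repr x + j%:~R * (2 * pi)); last by rewrite jE addrAC.
rewrite -[RHS]reprK; apply/eqmodP; rewrite /= /eq_mod2pi addrAC subrr add0r mulfK ?intr_int//.
by rewrite mulf_neq0// gt_eqF// pi_gt0.
Qed.

End CircleDistanceFacts.

(** * The noise part of the filtered sum, uniformly in x *)

Section Noise.
Context {R : realType}.
Variable H : R -> R.
Hypothesis hH : low_pass_filter H.
Variable n : nat.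
Hypothesis n0 : (0 < n)%N.

(** The formula of [sigma] on the real line, where continuity makes sense; [sigma] at x is its value
    at [repr x]. *)
Definition trig_sum (mu : int -> R[i]) (x : R) : R[i] :=
  (hbar H n)%:C%C *
  \sum_(l \in freqs n) (H (`|l|%N%:R / n%:R))%:C%C * mu l * expi (l%:~R * x).

Lemma trig_sum_2piz mu x (j : int) : trig_sum mu (x + j%:~R * (2 * pi)) = trig_sum mu x.
Proof.
rewrite /trig_sum !sum_freqs; congr (_ * _); apply: eq_bigr => l _.
by rewrite mulrDr mulrA -intrM expi_2piz.
Qed.

Let c (l : int) : R := hbar H n * H (`|l|%N%:R / n%:R).

Lemma trig_sumE mu x :
  trig_sum mu x = \sum_(l <- freqs_seq n) (c l)%:C%C * (mu l * expi (l%:~R * x)).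
Proof.
rewrite /trig_sum sum_freqs mulr_sumr; apply: eq_bigr => l _.
by rewrite mulrA /c rmorphM !mulrA.
Qed.

Lemma weight_ge0 l : 0 <= c l.
Proof.
by rewrite mulr_ge0 ?(ltW (hbar_gt0 hH n0))//; case/andP: (low_pass_weight01 hH n l).
Qed.

Lemma weight_sum : \sum_(l <- freqs_seq n) c l = 1.
Proof. by rewrite -mulr_sumr -sum_freqs hbar_sum. Qed.

(** Each weight is at most [hbar H n] and they sum to 1. This variance bound is the source of the
    decay of the noise in 1/sqrt(n). *)
Lemma weight_sum_sqr : \sum_(l <- freqs_seq n) c l ^+ 2 <= n%:R^-1.
Proof.
apply: le_trans (hbar_le hH n0).
rewrite -[leRHS]mulr1 -[X in _ <= _ * X]weight_sum mulr_sumr; apply: ler_sum => l _.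
rewrite expr2 ler_wpM2r ?weight_ge0// ler_piMr ?(ltW (hbar_gt0 hH n0))//.
by case/andP: (low_pass_weight01 hH n l).
Qed.

Lemma continuous_cmod_trig_sum mu : continuous (fun x => cmod (trig_sum mu x)).
Proof.
pose B := 2 * n%:R * \sum_(l <- freqs_seq n) c l * cmod (mu l).
have B0 : 0 <= B.
  by rewrite !mulr_ge0// sumr_ge0// => l _; rewrite mulr_ge0 ?weight_ge0 ?cmod_ge0.
have lip x y : `|cmod (trig_sum mu x) - cmod (trig_sum mu y)| <= B * `|x - y|.
  apply: (@le_trans _ _ (cmod (trig_sum mu x - trig_sum mu y))).
    have h (u v : R[i]) : cmod u - cmod v <= cmod (u - v).
      by rewrite lerBlDr -{1}(subrK v u) cmodD.
    rewrite ler_norml h andbT lerNl opprB; apply: le_trans (h _ _) _.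
    by rewrite -cmodN opprB.
  rewrite !trig_sumE -sumrB; apply: le_trans (cmod_sum _ _ _) _.
  rewrite /B mulrAC mulr_sumr big_seq [leRHS]big_seq; apply: ler_sum => l ls.
  rewrite -mulrBr -mulrBr !Normc.normcM cmod_real (ger0_norm (weight_ge0 l)).
  rewrite [leRHS]mulrC mulrA ler_wpM2l ?(mulr_ge0 (weight_ge0 l) (cmod_ge0 _))//.
  have ln : `|l%:~R * x - l%:~R * y| <= n%:R * `|x - y|.
    by rewrite -mulrBr normrM ler_wpM2r// norm_freqs.
  apply: le_trans (cmod_le_ReIm _) _.
  have := cos_lipschitz (l%:~R * y) (l%:~R * x).
  by have := sin_lipschitz (l%:~R * y) (l%:~R * x); rewrite /expi /=; lra.
move=> x; apply/cvgrPdist_le => e e0; near=> y.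
apply: le_trans (lip x y) _.
have xy : `|x - y| <= e / (B + 1).
  near: y; apply/nbhs_ballP; exists (e / (B + 1)) => [/=|y]; last exact: ltW.
  by rewrite divr_gt0//; lra.
apply: le_trans (ler_wpM2l B0 xy) _.
by rewrite mulrA ler_pdivrMr; [nra|lra].
Unshelve. all: by end_near. Qed.

Context d (Omega : measurableType d) (P : probability Omega R).

Lemma noise_bound (V delta : R) (eps : int -> Omega -> R[i]) :
  0 < V -> 0 < delta < 1 ->
  (forall l, freqs n l -> csubgaussian P V (eps l)) ->
  cindependent P (freqs n) eps ->
  exists B : set Omega, [/\ measurable B, (P B < delta%:E)%E
    & forall w, ~ B w -> forall x, cmod (trig_sum (fun l => eps l w) x) <=
      16 * V * Num.sqrt (ln (10 * n%:R / delta) / n%:R)].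
Proof.
move=> V0 d01 heps ind; have /andP[d0 d1] := d01.
pose phi (b : bool) : R -> R := if b then cos else sin.
pose X (b : bool) l w := if b then complex.Re (eps l w) else complex.Im (eps l w).
have philip b x y : `|phi b x - phi b y| <= `|x - y|.
  by case: b; [exact: cos_lipschitz|exact: sin_lipschitz].
have phi1 b x : `|phi b x| <= 1.
  by case: b; rewrite ler_norml ?cos_le1 ?cos_geN1 ?sin_le1 ?sin_geN1.
have sX b l : l \in freqs_seq n -> subgaussian P V (X b l).
  rewrite mem_freqs_seq => ln; have [h1 h2] := heps l ln.
  by case: b.
have indX b : rindependent P (freqs_seq n) (X b).
  case: b.
    exact: (cindependent_comp (g := fst)).
  exact: (cindependent_comp (g := snd)).
(* Four real sums, cosine or sine against real or imaginary part; each is at most 4 V t, whence the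
   constant 16. *)
pose S (b : bool * bool) w x :=
  \sum_(l <- freqs_seq n) c l * phi b.1 (l%:~R * x) * X b.2 l w.
set t := Num.sqrt _.
have [B [mB PB BP]] : exists B : set Omega, [/\ measurable B,
    (P B <= ((size [:: (true, true); (true, false); (false, true); (false, false)])%:R *
      (10 * n%:R ^+ 2 * (2 * (10 * n%:R / delta) ^- 2)))%:E)%E
    & forall w, ~ B w -> forall b,
      b \in [:: (true, true); (true, false); (false, true); (false, false)] ->
      forall x, 0 <= x < 2 * pi -> `|S b w x| <= 4 * V * t].
  apply: union_bound => b _.
  exact: (noise_part_bound n0 V0 d01 weight_ge0 weight_sum weight_sum_sqr
    (@philip b.1) (@phi1 b.1) (@sX b.2) (@indX b.2)).
exists B; split=> //.
  apply: le_lt_trans PB _; rewrite lte_fin /=.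
  have nn : n%:R != 0 :> R by rewrite pnatr_eq0 lt0n_neq0.
  (* Four families of at most 10 n^2 tests, each failing with probability at most 2 (10 n /
     delta)^-2; the factor 10 inside the logarithm makes the total less than delta. *)
  rewrite (_ : _ * _ = 80 / 100 * delta ^+ 2); last by field; rewrite nn gt_eqF.
  by rewrite expr2; nra.
move=> w /BP {}BP x.
have [j /andP[x0 x1]] := reduce_2pi x 0.
rewrite -(trig_sum_2piz _ x j); move: (x + _) x0 x1 => {}x x0 x1.
rewrite add0r in x1; have x01 : 0 <= x < 2 * pi by rewrite x0.
apply: le_trans (cmod_le_ReIm _) _.
have -> : complex.Re (trig_sum (fun l => eps l w) x) = S (true, true) w x - S (false, false) w x.
  rewrite trig_sumE Re_sum /S -sumrB; apply: eq_bigr => l _.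
  by rewrite Re_mul_real /X /phi/=; case: (eps l w) => a b /=; ring.
have -> : complex.Im (trig_sum (fun l => eps l w) x) = S (true, false) w x + S (false, true) w x.
  rewrite trig_sumE Im_sum /S -big_split/=; apply: eq_bigr => l _.
  by rewrite Im_mul_real /X /phi/=; case: (eps l w) => a b /=; ring.
have b1 := BP (true, true) isT x x01; have b2 := BP (true, false) isT x x01.
have b3 := BP (false, true) isT x x01; have b4 := BP (false, false) isT x x01.
have := ler_normB (S (true, true) w x) (S (false, false) w x).
have := ler_normD (S (true, false) w x) (S (false, true) w x).
lra.
Qed.

End Noise.

(** * From bounds on the modulus to the structure of the level set *)

Section Localization.
Context {R : realType}.

(** The piece [G_ l] is the part of the level set within C/n of [lam l]. By the bound far from all
    the centres the pieces exhaust the level set, and centres 4C/n apart keep them disjoint. *)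
Lemma localization (K : nat) (lam : 'I_K -> circle R) (s : R -> R[i])
    (eta : \bar R) (m C n : R) :
  1 <= C -> 0 < n ->
  (forall r (j : int), s (r + j%:~R * (2 * pi)) = s r) ->
  continuous (fun r => cmod (s r)) ->
  (forall l k, l != k -> 4 * C / n <= cdist (lam l) (lam k)) ->
  (forall l k, l != k -> (eta <= (cdist (lam l) (lam k))%:E)%E) ->
  (forall x : circle R, (forall k, C / n <= cdist x (lam k)) ->
    cmod (s (repr x)) < m / 2) ->
  (forall l (x : circle R), cdist x (lam l) <= (4 * n)^-1 ->
    m / 2 <= cmod (s (repr x))) ->
  exists G_ : 'I_K -> set (circle R),
    [/\ [/\ [set x : circle R | m / 2 <= cmod (s (repr x))] = \bigcup_l G_ l,
          trivIset [set: 'I_K] G_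
          & forall l, G_ l !=set0],
        forall l, (cdiam (G_ l) <= (2 * C / n)%:E)%E,
        forall l k, l != k -> (eta / 2%:E <= cset_dist (G_ l) (G_ k))%E,
        forall l, [set x | cdist x (lam l) <= (4 * n)^-1] `<=` G_ l
      & forall l,
          (exists x, is_argmax (G_ l) (fun y => cmod (s (repr y))) x) /\
          (forall x, is_argmax (G_ l) (fun y => cmod (s (repr y))) x ->
             cdist x (lam l) <= 2 * C / n)].
Proof.
move=> C1 n0 sper scont sep etasep far near.
have Cn0 : 0 < C / n by rewrite divr_gt0//; lra.
have C2 : 2 * C / n = C / n + C / n by rewrite -mulrA mulr_natl mulr2n.
have C4 : 4 * C / n = C / n + C / n + (C / n + C / n) by rewrite -C2; lra.
have n4 : (4 * n)^-1 <= C / n.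
  rewrite invfM ler_wpM2r ?invr_ge0 ?(ltW n0)//; lra.
have n40 : 0 <= (4 * n)^-1 by rewrite invr_ge0; lra.
have s_pi r : s (repr (\pi_(circle R)%qT r)) = s r.
  by have [j ->] := repr_pi r.
pose G_ l := [set x : circle R | m / 2 <= cmod (s (repr x)) /\ cdist x (lam l) <= C / n].
have nearG l : [set x | cdist x (lam l) <= (4 * n)^-1] `<=` G_ l.
  by move=> x /= xl; split; [exact: near xl|exact: le_trans xl n4].
have lamG l : G_ l (lam l) by apply: nearG; rewrite /= cdistxx.
have diamG l x y : G_ l x -> G_ l y -> cdist x y <= 2 * C / n.
  move=> [_ xl] [_ yl]; apply: le_trans (cdist_triangle (lam l) _ _) _.
  by rewrite C2 (cdistC _ y) lerD.
have sepG l k x y : G_ l x -> G_ k y -> cdist (lam l) (lam k) <= cdist x y + 2 * C / n.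
  move=> [_ xl] [_ yl]; have := cdist_triangle x (lam l) (lam k).
  have := cdist_triangle y x (lam k); move: xl; rewrite cdistC C2; lra.
exists G_; split.
- split.
  + apply/seteqP; split => [x /= xm|x [l _ [xm _]]//].
    apply: contrapT => h.
    have : cmod (s (repr x)) < m / 2.
      apply: far => k; rewrite leNgt; apply/negP => xk.
      by apply: h; exists k => //; split=> //; exact: ltW.
    by rewrite ltNge xm.
  + move=> l k _ _ [x [xl xk]]; apply/eqP; apply: contraT => lk.
    by have := sepG _ _ _ _ xl xk; have := sep _ _ lk; rewrite cdistxx C4 C2; lra.
  + by move=> l; exists (lam l).
- move=> l; apply: ge_ereal_sup => _ [[x y] /= [xl yl] <-].
  by rewrite lee_fin; exact: diamG xl yl.
- move=> l k lk; apply: le_ereal_inf_tmp => _ [[x y] /= [xl yl] <-].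
  (* Two pieces are at distance at least that of their centres minus 2C/n, and 2C/n is at most half
     of the former. *)
  apply: (@le_trans _ _ ((cdist (lam l) (lam k))%:E / 2%:E)%E).
    by rewrite lee_wpmul2r ?inve_ge0 ?lee_fin//; exact: etasep.
  rewrite inver ifF; last by apply/negbTE.
  rewrite -EFinM lee_fin; have := sepG _ _ _ _ xl yl; have := sep _ _ lk.
  by rewrite C4 C2; lra.
- exact: nearG.
- move=> l; split; last by move=> x [[_ xl] _]; apply: le_trans xl _; rewrite C2; lra.
  (* The maximum over the closed arc is attained, and its value is at least that at [lam l], hence
     at least m/2: the maximizer lies in [G_ l]. *)
  have [c] : exists2 c, c \in `[repr (lam l) - C / n, repr (lam l) + C / n]%R &
      forall t, t \in `[repr (lam l) - C / n, repr (lam l) + C / n]%R ->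
      cmod (s t) <= cmod (s c).
    by apply: EVT_max; [lra|exact: continuous_subspaceT].
  rewrite in_itv/= => cI cmax; exists (\pi_(circle R)%qT c); split.
    split; last by apply: le_trans (cdist_pi_le _ _) _; rewrite ler_norml; lra.
    rewrite s_pi; apply: le_trans (cmax (repr (lam l)) _).
      by have [] := lamG l.
    by rewrite in_itv/=; lra.
  move=> y [_ yl]; have [r yr rE] := cdist_lift y (lam l).
  rewrite -yr !s_pi; apply: cmax; move: yl; rewrite rE ler_norml in_itv/=; lra.
Qed.

Lemma bigmin_fine (K : nat) (F : 'I_K -> R) : (0 < K)%N -> (forall k, 0 < F k) ->
  let m := fine (\big[mine/+oo%E]_(k < K) (F k)%:E) in
  0 < m /\ forall k, m <= F k.
Proof.
case: K F => // K F _ F0 m.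
have [|k0 _ mE] := @eq_bigmin _ (\bar R) 'I_K.+1 +oo%E ord0 predT
  (fun k => (F k)%:E) isT; first by move=> k _; rewrite leey.
rewrite {}/m mE; split=> [|k]; first exact: F0.
by rewrite -lee_fin -mE bigmin_le.
Qed.

End Localization.

(** * Contribution of a single frequency *)

Section PeakSeparation.
Context {R : realType}.
Variable H : R -> R.
Hypothesis hH : low_pass_filter H.
Variable n : nat.
Hypothesis n0 : (0 < n)%N.

Lemma trig_sum_exp_sum (K : nat) (lam : 'I_K -> circle R) (A : 'I_K -> R[i])
    (e : int -> R[i]) r :
  trig_sum H n (fun l => exp_sum lam A l + e l) r =
  \sum_(k < K) A k * kernel H n (r - repr (lam k)) + trig_sum H n e r.
Proof.
rewrite /trig_sum /kernel !sum_freqs.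
under eq_bigr do rewrite mulrDr mulrDl.
rewrite big_split mulrDr; congr (_ + _).
under [RHS]eq_bigr do rewrite sum_freqs mulrCA mulr_sumr.
rewrite -mulr_sumr exchange_big; congr (_ * _); apply: eq_bigr => l _ /=.
rewrite /exp_sum mulr_sumr mulr_suml; apply: eq_bigr => k _.
rewrite (_ : l%:~R * (r - _) = - (l%:~R * repr (lam k)) + l%:~R * r); last by ring.
by rewrite expiD; ring.
Qed.

(** The decay bound gives |Phi| C^S <= L at this distance, and C is defined so that C^S >= 16 M L /
    m. *)
Lemma kernel_far (S : nat) (M m : R) (x y : circle R) : (2 <= S)%N -> 0 < m -> 0 <= M ->
  let L := (14 * Num.sqrt (2 * pi) / 3) * (norm1 (derive1n S H) / norm1 H) in
  let C := Num.max 1 ((16 * M * L / m) `^ S%:R^-1) in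
  C / n%:R <= cdist x y -> cmod (kernel H n (repr x - repr y)) * (16 * M) <= m.
Proof.
move=> S2 m0 M0 L C Cxy.
have nn : 0 < n%:R :> R by rewrite ltr0n.
have [j [jE jpi]] := cdist_attained x y.
rewrite -(kernel_2piz H n _ j); move: (_ + j%:~R * _) jE => r rE.
have := cmod_kernel_decay hH n0 S2 (_ : `|r| <= pi); rewrite -rE -/L => /(_ jpi).
have := cmod_ge0 (kernel H n r); move: (cmod _) => u u0 uL.
have C1 : 1 <= C by rewrite le_max lexx.
have L0 : 0 <= L.
  rewrite mulr_ge0 ?divr_ge0 ?mulr_ge0//; exact: Rintegral_ge0.
have CL : 16 * M * L / m <= C ^+ S.
  have a0 : 0 <= 16 * M * L / m by rewrite divr_ge0 ?(ltW m0)// mulr_ge0// mulr_ge0.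
  rewrite -[leLHS](powRr1 a0) -[X in _ `^ X](mulVf (x := S%:R)); last first.
    by rewrite pnatr_eq0; case: (S) S2.
  rewrite powRrM powR_mulrn ?powR_ge0// lerXn2r ?nnegrE ?powR_ge0//.
    by rewrite (le_trans ler01).
  by rewrite le_max lexx orbT.
have CS : C ^+ S <= (n%:R * cdist x y) ^+ S.
  have C0 : 0 <= C by rewrite (le_trans ler01).
  rewrite lerXn2r ?nnegrE ?mulr_ge0 ?cdist_ge0 ?(ltW nn)//.
  by move: Cxy; rewrite ler_pdivrMr// mulrC.
have uC : u * C ^+ S <= L by apply: le_trans uL; rewrite ler_wpM2l.
(* When L = 0 one cannot divide by it; then C >= 1 forces the kernel to vanish. *)
have [L00|Lp] := eqVneq L 0.
  have : u * 1 <= L by apply: le_trans uC; rewrite ler_wpM2l// exprn_ege1.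
  rewrite L00 mulr1 => u00; have -> : u = 0 by apply/eqP; rewrite eq_le u00.
  by rewrite mul0r ltW.
have {Lp}L0 : 0 < L by rewrite lt_neqAle eq_sym Lp.
have : u * (16 * M * L / m) <= L by apply: le_trans uC; rewrite ler_wpM2l.
rewrite mulrA ler_pdivrMr// (_ : u * (16 * M * L) = L * (u * (16 * M))); last by ring.
by rewrite ler_pM2l.
Qed.

End PeakSeparation.

(** * Assembly of the estimates *)

Theorem theorem2p3p1 (R : realType) (H : R -> R) (hH : low_pass_filter H) :
  exists C1 C2 C3 : R, [/\ 1 <= C1, 0 < C2 & 0 < C3] /\
  forall (S : nat) (hS : (2 <= S)%N)
    (K : nat) (hK : (1 <= K)%N)
    (lam : 'I_K -> circle R) (hlam : injective lam)
    (A : 'I_K -> R[i]) (hA : forall k, A k != 0)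
    (n : nat) (hn : (1 <= n)%N)
    (d : measure_display) (Omega : measurableType d) (P : probability Omega R)
    (V : R) (hV : 0 <= V)
    (eps : int -> Omega -> R[i])
    (heps : forall l, freqs n l -> csubgaussian P V (eps l))
    (hindep : cindependent P (freqs n) eps)
    (delta : R) (hdelta : 0 < delta < 1),
  let M := \sum_(k < K) cmod (A k) in
  let m := min_cmod A in
  let eta := min_sep lam in
  let L := (14 * Num.sqrt (2 * pi) / 3) * (norm1 (derive1n S H) / norm1 H) in
  let C := Num.max 1 ((16 * M * L / m) `^ S%:R^-1) in
  let sigma_n (w : Omega) (x : circle R) :=
    sigma H n (fun l => exp_sum lam A l + eps l w) x in
  let G (w : Omega) := [set x : circle R | m / 2 <= cmod (sigma_n w x)] in
  (maxe ((4 * C)%:E / eta) C1%:E <= n%:R%:E)%E ->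
  C2 * V * Num.sqrt (ln (C3 * n%:R / delta) / n%:R) <= m / 16 ->
  exists E : set Omega,
    [/\ measurable E, ((1 - delta)%:E < P E)%E &
    forall w, E w ->
    exists G_ : 'I_K -> set (circle R),
      [/\ [/\ G w = \bigcup_l G_ l, trivIset [set: 'I_K] G_
            & forall l, G_ l !=set0],
          forall l, (cdiam (G_ l) <= (2 * C / n%:R)%:E)%E,
          forall l k, l != k -> (eta / 2%:E <= cset_dist (G_ l) (G_ k))%E,
          forall l, [set x | cdist x (lam l) <= (4 * n%:R)^-1] `<=` G_ l
        & forall l,
            (exists x, is_argmax (G_ l) (fun y => cmod (sigma_n w y)) x) /\
            (forall x, is_argmax (G_ l) (fun y => cmod (sigma_n w y)) x ->
               cdist x (lam l) <= 2 * C / n%:R)]].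
Proof.
(* The kernel bounds hold for every n >= 1; 16 and 10 are the constants of [noise_bound]. *)
exists 1, 16, 10; split; first by split; lra.
move=> S hS K hK lam hlam A hA n hn d Omega P V hV eps heps hindep delta hdelta.
move=> M m eta L C sigma_n G hmax hnoise.
have /andP[d0 d1] := hdelta.
have nn : 0 < n%:R :> R by rewrite ltr0n.
have n1 : 1 <= n%:R :> R by rewrite ler1n.
have A0 k : 0 < cmod (A k).
  rewrite lt_neqAle cmod_ge0 andbT eq_sym; apply: contra (hA k) => /eqP.
  by move=> /Normc.eq0_normc ->.
have [m0 mA] : 0 < m /\ forall k, m <= cmod (A k) by exact: bigmin_fine hK A0.
have mM : m <= M.
  apply: le_trans (mA (Ordinal hK)) _; rewrite /M (bigD1 (Ordinal hK))//= lerDl.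
  by apply: sumr_ge0 => k _; exact: cmod_ge0.
have M0 : 0 < M by exact: lt_le_trans mM.
have C1 : 1 <= C by rewrite le_max lexx.
have etaE l k : l != k -> (eta <= (cdist (lam l) (lam k))%:E)%E.
  move=> lk; exact: (bigmin_le_cond _ _ (j := (l, k)) (P := fun p => p.1 != p.2)).
have eta0 : (0 <= eta)%E by apply: le_bigmin => // p _; rewrite lee_fin cdist_ge0.
have sep l k : l != k -> 4 * C / n%:R <= cdist (lam l) (lam k).
  move=> lk; move: hmax; rewrite ge_max => /andP[+ _].
  move: eta0 (etaE l k lk); case: (eta) => [e| |]//; rewrite !lee_fin => e0 ecd.
  (* The value 0 for eta is excluded here: its inverse is +oo, so 4C/eta could not be bounded by
     n. *)
  rewrite inver; case: eqVneq => [_|e_neq0].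
    by rewrite gt0_muley ?lte_fin//; lra.
  have ep : 0 < e by rewrite lt_neqAle eq_sym e_neq0.
  rewrite -EFinM lee_fin ler_pdivrMr// => h; rewrite ler_pdivrMr//.
  by apply: le_trans h _; rewrite mulrC ler_wpM2r// ltW.
set t := Num.sqrt (ln (10 * n%:R / delta) / n%:R) in hnoise.
have t0 : 0 < t.
  rewrite sqrtr_gt0 divr_gt0// ln_gt0// ltr_pdivlMr//; lra.
(* [V] may vanish, whereas the Chernoff bound needs a positive parameter. *)
pose V' := m / 16 / (16 * t).
have VV' : 0 <= V <= V'.
  rewrite hV ler_pdivlMr; last by rewrite mulr_gt0.
  by rewrite mulrCA mulrA.
have V'0 : 0 < V' by rewrite !divr_gt0// mulr_gt0.
have [] := @noise_bound R H hH n hn d Omega P V' delta eps V'0 hdelta _ hindep.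
  by move=> l /heps[h1 h2]; split; exact: subgaussian_le VV' _.
move=> B [mB PB BP].
have V't : 16 * V' * t = m / 16.
  by rewrite /V'; field; rewrite gt_eqF.
exists (~` B); split; first exact: measurableC.
  rewrite probability_setC//; move: PB.
  rewrite -(fineK (fin_num_measure P B mB)) -EFinB !lte_fin; lra.
move=> w wB; have {BP wB} noise x := BP w wB x; rewrite -/t V't in noise.
(* [Q] will be all indices when x is far from every [lam k], and all but l when x is near
   [lam l]. *)
have Aker (x : circle R) (Q : pred 'I_K) :
    (forall k, Q k -> C / n%:R <= cdist x (lam k)) ->
    \sum_(k < K | Q k) cmod (A k * kernel H n (repr x - repr (lam k))) <= m / 16.
  move=> hQ; apply: (@le_trans _ _ (\sum_(k < K | Q k) cmod (A k) * (m / (16 * M)))).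
    apply: ler_sum => k /hQ Qk; rewrite Normc.normcM ler_wpM2l ?cmod_ge0//.
    rewrite ler_pdivlMr; last by rewrite mulr_gt0.
    exact: (kernel_far hH hn hS m0 (ltW M0)).
  rewrite -mulr_suml; apply: (@le_trans _ _ (M * (m / (16 * M)))).
    rewrite ler_wpM2r ?divr_ge0 ?mulr_ge0 ?(ltW m0) ?(ltW M0)//.
    rewrite /M [leRHS](bigID Q)/= lerDl; apply: sumr_ge0 => k _; exact: cmod_ge0.
  by rewrite le_eqVlt; apply/orP; left; apply/eqP; field; rewrite gt_eqF.
apply: (@localization R K lam
  (trig_sum H n (fun l => exp_sum lam A l + eps l w)) eta m C n%:R) => //.
- by move=> r j; exact: trig_sum_2piz.
- exact: continuous_cmod_trig_sum.
- move=> x xfar; rewrite trig_sum_exp_sum.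
  have := Aker x predT (fun k _ => xfar k).
  have := cmod_sum (index_enum 'I_K) predT
    (fun k => A k * kernel H n (repr x - repr (lam k))).
  set z := \sum_(k < K) _ => h1 h2; apply: le_lt_trans (cmodD _ _) _.
  by have := noise (repr x); lra.
(* The main term is at least 31m/32, and the other frequencies and the noise take away at most m/16
   each. The other centres are at distance at least 4C/n - 1/(4n) >= C/n from x. *)
- move=> l x xl; rewrite trig_sum_exp_sum (bigD1 l)//=.
  have xn : (4 * n%:R)^-1 <= C / n%:R.
    by rewrite invfM ler_wpM2r ?invr_ge0 ?(ltW nn)//; lra.
  have h1 : \sum_(k < K | k != l) cmod (A k * kernel H n (repr x - repr (lam k))) <= m / 16.
    apply: Aker => k kl; have := sep k l kl; have := cdist_triangle x (lam k) (lam l).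
    have : 0 <= C / n%:R by rewrite divr_ge0 ?(ltW nn)// (le_trans ler01).
    by rewrite (cdistC (lam k) x) -!mulrA; lra.
  have := cmod_sum (index_enum 'I_K) (fun k => k != l)
    (fun k => A k * kernel H n (repr x - repr (lam k))).
  set a := A l * _; set b := \sum_(k < K | _) _ => h2.
  have ha : 31 / 32 * m <= cmod a.
    rewrite Normc.normcM [leLHS]mulrC; apply: ler_pM; [exact: ltW|lra|exact: mA|].
    have [j [jE _]] := cdist_attained x (lam l).
    by rewrite -(kernel_2piz H n _ j); apply: cmod_kernel_near => //; rewrite -jE.
  have hn' := noise (repr x); move: (trig_sum _ _ _ _) hn' => e he.
  have := cmodD (a + b + e) (- (b + e)); rewrite -(addrA a b e) addrK cmodN.
  have := cmodD b e.
  by move: h1 h2; lra.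
Qed.
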